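(* For any sequence $\varrho=(r_n)_{n\in\mathbb{N}}$ in $[0,1)$ converging to $1$ and any integer $l\geq 1$, there exists $f\in\mathcal{U}_A(\mathbb{D},\varrho)$ such that the $l$-th derivative $f^{(l)}$ does not belong to $\mathcal{U}_A(\mathbb{D},\varrho)$.
   Context: $\mathbb{D}$ is the open unit disc of $\mathbb{C}$, $\mathbb{T}$ the unit circle, $H(\mathbb{D})$ the space of holomorphic functions on $\mathbb{D}$. $\mathcal{U}_A(\mathbb{D},\varrho)$ ($\varrho$-Abel universal functions) is the set of $f\in H(\mathbb{D})$ such that for every compact $K\subset\mathbb{T}$ with $K\neq\mathbb{T}$, the set $\{z\mapsto f(r_nz)|_K : n\in\mathbb{N}\}$ is dense in the space $\mathcal{C}(K)$ of continuous complex functions on $K$ with the uniform norm. *)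

(* Defs.v *)
From HB Require Import structures.
From mathcomp Require Import all_boot all_order all_algebra.
From mathcomp Require Import complex.
From mathcomp Require Import all_classical all_reals all_analysis.

Set Implicit Arguments.
Unset Strict Implicit.
Unset Printing Implicit Defensive.

Import Order.TTheory GRing.Theory Num.Theory.
Import numFieldNormedType.Exports.

Local Open Scope classical_set_scope.
Local Open Scope ring_scope.
Local Open Scope complex_scope.

(* R[i] is seen as a numFieldType so that it carries the topology induced by
   its own norm; differentiability and derivatives over this field are the
   complex ones. *)
Definition Cplx (R : realType) : numFieldType := R[i].

(* The norm of Cplx R takes its values in Cplx R, and [z < 1] means that z is
   real and smaller than 1. *)
Definition unit_disc (R : realType) : set (Cplx R) := [set z | `|z| < 1].

Definition unit_circle (R : realType) : set (Cplx R) := [set z | `|z| = 1].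

(* H(D): the elements are total functions, whose values outside the disc are
   irrelevant. *)
Definition holomorphic_disc (R : realType) : set (Cplx R -> Cplx R) :=
  [set f | forall z, @unit_disc R z -> derivable f z 1].

Definition dilate (R : realType) (f : Cplx R -> Cplx R) (r : R) :
  Cplx R -> Cplx R := fun z => f (r%:C * z).

(* C(K) with the uniform norm is rendered inside {uniform` K -> Cplx R}, whose
   topology only looks at the restrictions to K. *)
Definition Abel_universal (R : realType) (rho : nat -> R) :
    set (Cplx R -> Cplx R) :=
  [set f | holomorphic_disc f /\
    forall K : set (Cplx R), compact K -> K `<=` @unit_circle R ->
      K <> @unit_circle R ->
      [set g : {uniform` K -> Cplx R} | {within K, continuous g}] `<=`
      closure (range (fun n => dilate f (rho n) : {uniform` K -> Cplx R}))].

(* Main.v *)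
Require Import Defs.
From HB Require Import structures.
From mathcomp Require Import all_boot all_order all_algebra.
From mathcomp Require Import complex.
From mathcomp Require Import all_classical all_reals all_analysis.
From mathcomp Require Import cyclic separable cyclotomic.
From mathcomp Require Import ring lra.

Set Implicit Arguments.
Unset Strict Implicit.
Unset Printing Implicit Defensive.

Import Order.TTheory GRing.Theory Num.Theory.
Import numFieldNormedType.Exports.

Local Open Scope classical_set_scope.
Local Open Scope ring_scope.
Local Open Scope complex_scope.

(** The values of [f] on the circles of radius [rho n] only depend on the set of
    the radii, so these may be listed as a strictly increasing sequence [x].
    The function is a series [f = \sum_j P j] of polynomials. The term
    [P j.+1] is small, together with its [l]-th derivative, on the disc of
    radius [x j], and on the circle of radius [x j.+1] it does two things.
    - It brings the partial sum close to a prescribed polynomial on a prescribed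
      arc. Since polynomials are dense in the continuous functions on a proper
      compact subset of the circle ([poly_dense_arc]), and since countably many
      arcs and polynomials suffice, each occurring infinitely often
      ([tasks_exist]), this makes [f] universal.
    - It makes the [l]-th derivative of the partial sum at the point [x j.+1] of
      modulus at least 2. This costs nothing: the monomial
      [e * (z / r) ^ N] is bounded by [e] on the disc of radius [r], whereas its
      [l]-th derivative at [r] tends to infinity with [N] ([stage]).
    The later terms change the derivative at [x j] by at most 1, so the
    [l]-th derivative of [f] has modulus at least 1 at every radius. Its
    dilates therefore stay away from 0 on the compact set reduced to the
    point 1, and it is not universal.

    The first item needs polynomials that are close to 1 on an arc of the circle
    of radius [r] and close to 0 on a smaller concentric disc
    ([disc_arc_separation]), a case of the theorem of Runge. A Cayley transform
    with its pole in the gap of the arc is a uniform limit of polynomials by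
    pole pushing ([apx_inv_ray]). It maps the arc and the disc to compact sets
    separated by a vertical line. Once this line is moved to the imaginary axis,
    Newton's iteration [x |-> (x + 1/x) / 2] tends to the sign of the real part
    without leaving the uniform closure of the polynomials ([apx_sign]). On the
    arc the transform takes values in a bounded segment of the imaginary axis,
    and Bernstein polynomials in its imaginary part give the density theorem.

    Holomorphy and termwise differentiation of the series follow from Cauchy
    estimates for polynomials, obtained by averaging over roots of unity
    ([cauchy_coef]). *)

(* The coordinates with values in [R], as opposed to ['Re] and ['Im]. *)
Local Notation Re := (@complex.Re _).
Local Notation Im := (@complex.Im _).

(** * The modulus of a complex number as a real number *)

(** The modulus with values in the real field, so that inequalities between
    moduli live in a totally ordered field; the norm of [R[i]] is its image
    under the embedding of [R] (lemma [normC_cmod]). *)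
Definition cmod (R : realType) (z : R[i]) : R := Normc.normc z.

Section Modulus.
Variable R : realType.
Local Notation C := R[i].
Implicit Types (x y z : C) (a : R).

Lemma normC_cmod z : `|z| = (cmod z)%:C. Proof. by []. Qed.

Lemma cmod_ge0 z : 0 <= cmod z.
Proof. by rewrite -ler0c -normC_cmod normr_ge0. Qed.

Lemma cmodM x y : cmod (x * y) = cmod x * cmod y.
Proof. exact: Normc.normcM. Qed.

Lemma cmodD x y : cmod (x + y) <= cmod x + cmod y.
Proof. exact: le_normcD. Qed.

Lemma cmodN x : cmod (- x) = cmod x.
Proof. exact: normcN. Qed.

Lemma cmodB x y : cmod (x - y) <= cmod x + cmod y.
Proof. by rewrite -(cmodN y) cmodD. Qed.

Lemma cmodBC x y : cmod (x - y) = cmod (y - x).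
Proof. by rewrite -cmodN opprB. Qed.

Lemma cmod_leB x y : cmod x - cmod y <= cmod (x - y).
Proof. by rewrite lerBlDr -{1}(subrK y x) cmodD. Qed.

Lemma cmod0 : cmod (0 : C) = 0.
Proof. exact: Normc.normc0. Qed.

Lemma cmod1 : cmod (1 : C) = 1.
Proof. exact: Normc.normc1. Qed.

Lemma cmod_eq0 z : (cmod z == 0) = (z == 0).
Proof.
by apply/eqP/eqP => [/Normc.eq0_normc //|->]; exact: cmod0.
Qed.

Lemma cmod_gt0 z : (0 < cmod z) = (z != 0).
Proof. by rewrite lt_neqAle cmod_ge0 andbT eq_sym cmod_eq0. Qed.

Lemma cmodV z : cmod z^-1 = (cmod z)^-1.
Proof. exact: Normc.normcV. Qed.

Lemma cmodX z n : cmod (z ^+ n) = cmod z ^+ n.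
Proof. by elim: n => [|n IH]; rewrite ?expr0 ?cmod1 // !exprS cmodM IH. Qed.

Lemma cmod_real a : cmod a%:C = `|a|.
Proof. by rewrite /cmod /= expr0n /= addr0 sqrtr_sqr. Qed.

Lemma cmod_sqr z : cmod z ^+ 2 = Re z ^+ 2 + Im z ^+ 2.
Proof.
by case: z => a b; rewrite /cmod /= sqr_sqrtr // addr_ge0 // sqr_ge0.
Qed.

Lemma cmod_nat n : cmod (n%:R : C) = n%:R.
Proof.
have -> : (n%:R : C) = (n%:R : R)%:C by rewrite rmorph_nat.
by rewrite cmod_real normr_nat.
Qed.

Lemma normr_Re_le z : `|Re z| <= cmod z.
Proof.
rewrite -(@ler_pXn2r _ 2) // ?nnegrE ?cmod_ge0 //.
by rewrite cmod_sqr real_normK ?num_real // lerDl sqr_ge0.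
Qed.

Lemma normr_Im_le z : `|Im z| <= cmod z.
Proof.
rewrite -(@ler_pXn2r _ 2) // ?nnegrE ?cmod_ge0 //.
by rewrite cmod_sqr real_normK ?num_real // lerDr sqr_ge0.
Qed.

Lemma cmodi : cmod ('i : C) = 1.
Proof. by rewrite /cmod /= expr0n expr1n add0r sqrtr1. Qed.

Lemma cmod_le_ReIm z : cmod z <= `|Re z| + `|Im z|.
Proof.
rewrite {1}(complexE z) (le_trans (cmodD _ _)) //.
by rewrite cmodM !cmod_real cmodi mul1r.
Qed.

Lemma cmod_sum (I : Type) (s : seq I) (F : I -> C) :
  cmod (\sum_(i <- s) F i) <= \sum_(i <- s) cmod (F i).
Proof.
elim: s => [|i s IH]; first by rewrite !big_nil cmod0.
by rewrite !big_cons (le_trans (cmodD _ _)) // lerD2l.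
Qed.

End Modulus.

(** * Uniform closure of the polynomials on a bounded set *)

Section UniformClosure.
Variable R : realType.
Local Notation C := R[i].
Implicit Types (f g x : C -> C) (p : {poly C}) (z : C).

Lemma poly_bounded_unit_disc p :
  exists B : R, 0 < B /\ forall z, cmod z <= 1 -> cmod p.[z] <= B.
Proof.
exists (1 + \sum_(i < size p) cmod p`_i); split.
  by rewrite ltr_pwDl // sumr_ge0 // => i _; exact: cmod_ge0.
move=> z z1; rewrite horner_coef (le_trans (cmod_sum _ _)) //.
rewrite ler_wpDl // ler_sum // => i _.
by rewrite cmodM cmodX ler_piMr ?cmod_ge0 // exprn_ile1 ?cmod_ge0.
Qed.

(** [poly_approx L f]: the restriction of [f] to [L] is a uniform limit of
    polynomials. *)
Definition poly_approx (L : C -> Prop) f :=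
  forall e : R, 0 < e ->
  exists p : {poly C}, forall z, L z -> cmod (f z - p.[z]) <= e.

Variable L : C -> Prop.
Hypothesis L_le1 : forall z, L z -> cmod z <= 1.
Local Notation apx := (poly_approx L).

Lemma apx_lim f :
  (forall e : R, 0 < e ->
     exists g, apx g /\ forall z, L z -> cmod (f z - g z) <= e) -> apx f.
Proof.
move=> H e e0; have e2 : 0 < e / 2 by rewrite divr_gt0.
have [g [ag fg]] := H _ e2; have [p gp] := ag _ e2.
exists p => z Lz; rewrite -(subrKA (g z)) (le_trans (cmodD _ _)) //.
by have := fg _ Lz; have := gp _ Lz; lra.
Qed.

Lemma apx_ext f g : (forall z, L z -> f z = g z) -> apx f -> apx g.
Proof.
move=> fg af e e0; have [p fp] := af e e0.
by exists p => z Lz; rewrite -fg // fp.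
Qed.

Lemma apx_poly p : apx (fun z => p.[z]).
Proof. by move=> e e0; exists p => z _; rewrite subrr cmod0 ltW. Qed.

Lemma apx_cst (c : C) : apx (fun=> c).
Proof. by apply: apx_ext (apx_poly c%:P) => z _; rewrite hornerC. Qed.

Lemma apx_id : apx id.
Proof. by apply: apx_ext (apx_poly 'X) => z _; rewrite hornerX. Qed.

Lemma apx_bounded f : apx f ->
  exists B : R, 0 < B /\ forall z, L z -> cmod (f z) <= B.
Proof.
move=> af; have [p fp] := af 1 ltr01.
have [B [B0 pB]] := poly_bounded_unit_disc p.
exists (1 + B); split=> [|z Lz]; first by rewrite addr_gt0.
rewrite -(subrK p.[z] (f z)) (le_trans (cmodD _ _)) // lerD ?fp //.
by rewrite pB // L_le1.
Qed.

Lemma apxD f g : apx f -> apx g -> apx (fun z => f z + g z).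
Proof.
move=> af ag e e0; have e2 : 0 < e / 2 by rewrite divr_gt0.
have [p fp] := af _ e2; have [q gq] := ag _ e2.
exists (p + q) => z Lz; rewrite hornerD opprD addrACA (le_trans (cmodD _ _)) //.
by have := fp _ Lz; have := gq _ Lz; lra.
Qed.

Lemma apxM f g : apx f -> apx g -> apx (fun z => f z * g z).
Proof.
move=> af ag e e0; have [B [B0 gB]] := apx_bounded ag.
have [|p fp] := af (e / (2 * B)); first by rewrite divr_gt0 // mulr_gt0.
have [A [A0 pA]] := poly_bounded_unit_disc p.
have [|q gq] := ag (e / (2 * A)); first by rewrite divr_gt0 // mulr_gt0.
exists (p * q) => z Lz; rewrite hornerM.
have -> : f z * g z - p.[z] * q.[z] =
  (f z - p.[z]) * g z + p.[z] * (g z - q.[z]) by ring.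
rewrite (le_trans (cmodD _ _)) // !cmodM.
have -> : e = e / (2 * B) * B + A * (e / (2 * A)) by field; rewrite !gt_eqF.
by rewrite lerD // ler_pM ?cmod_ge0 ?fp ?gB ?gq ?pA // L_le1.
Qed.

Lemma apxZ (c : C) f : apx f -> apx (fun z => c * f z).
Proof. by move=> af; apply: apxM => //; exact: apx_cst. Qed.

Lemma apxX f n : apx f -> apx (fun z => f z ^+ n).
Proof.
move=> af; elim: n => [|n IH].
  by apply: apx_ext (apx_cst 1) => z _; rewrite expr0.
by apply: apx_ext (apxM af IH) => z _; rewrite exprS.
Qed.

Lemma apx_sum n (F : nat -> C -> C) :
  (forall k, apx (F k)) -> apx (fun z => \sum_(k < n) F k z).
Proof.
move=> aF; elim: n => [|n IH].
  by apply: apx_ext (apx_cst 0) => z _; rewrite big_ord0.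
by apply: apx_ext (apxD IH (aF n)) => z _; rewrite big_ord_recr.
Qed.

Lemma expr_lt_eps (q e : R) : 0 <= q < 1 -> 0 < e -> exists n, q ^+ n <= e.
Proof.
move=> /andP[q0 q1] e0; have [->|qn0] := eqVneq q 0.
  by exists 1%N; rewrite expr1 ltW.
have qgt0 : 0 < q by rewrite lt_neqAle eq_sym qn0.
(* Bernoulli's inequality for the powers of 1/q *)
have bern n : 1 + n%:R * (q^-1 - 1) <= q^-1 ^+ n.
  have h0 : 0 <= q^-1 - 1 by rewrite subr_ge0 invf_ge1 // ltW.
  elim: n => [|n IH]; first by rewrite mul0r addr0 expr0.
  rewrite exprS; set u := q^-1 in h0 IH *.
  have u0 : 0 <= u by lra.
  apply: le_trans (ler_wpM2l u0 IH); rewrite -natr1.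
  have n0 : 0 <= n%:R :> R by [].
  suff : 0 <= n%:R * (u - 1) ^+ 2 by lra.
  by rewrite mulr_ge0 // sqr_ge0.
have h : 0 < q^-1 - 1 by rewrite subr_gt0 invf_gt1.
have [n nP] : exists n : nat, (e^-1) / (q^-1 - 1) < n%:R.
  exists (Num.bound (e^-1 / (q^-1 - 1))); apply: archi_boundP.
  by rewrite divr_ge0 ?invr_ge0 // ltW.
exists n; rewrite -[q]invrK exprVn -[e]invrK.
rewrite lef_pV2 ?posrE ?invr_gt0 ?exprn_gt0 ?invr_gt0 //.
by rewrite (le_trans _ (bern n)) // ltW // ltr_wpDl // -ltr_pdivrMr.
Qed.

(** The Neumann series. *)
Lemma apx_invB1 f (q : R) : apx f -> 0 <= q < 1 ->
  (forall z, L z -> cmod (f z) <= q) -> apx (fun z => (1 - f z)^-1).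
Proof.
move=> af q01 fq; apply: apx_lim => e e0; have /andP[q0 q1] := q01.
have q1' : 0 < 1 - q by rewrite subr_gt0.
have [n nP] := expr_lt_eps q01 (mulr_gt0 e0 q1').
exists (fun z => \sum_(k < n) f z ^+ k); split.
  by apply: (@apx_sum n (fun k z => f z ^+ k)) => k; exact: apxX.
move=> z Lz; have lb : 1 - q <= cmod (1 - f z).
  by rewrite (le_trans _ (cmod_leB _ _)) // cmod1 lerB // fq.
have n0 : 1 - f z != 0 by rewrite -cmod_gt0 (lt_le_trans q1').
have -> : (1 - f z)^-1 - \sum_(k < n) f z ^+ k = f z ^+ n / (1 - f z).
  apply: (mulIf n0); rewrite mulrBl mulVf // divfK //.
  have := subrX1 (f z) n; set S := \sum_(k < n) _ => eS.
  have -> : f z ^+ n = (f z - 1) * S + 1 by rewrite -eS subrK.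
  by ring.
rewrite cmodM cmodX cmodV ler_pdivrMr ?(lt_le_trans q1') //.
rewrite (le_trans (lerXn2r n _ _ (fq z Lz))) ?nnegrE ?cmod_ge0 //.
by rewrite (le_trans nP) // ler_wpM2l // ltW.
Qed.

(** Pole pushing: if [f] stays at distance at least [d] of the half-line
    [[t0, +oo[], then a pole at a large real number (where the Neumann series
    applies) can be moved down to [t0] by steps of length [d / 2]. *)
Lemma apx_inv_ray f (t0 d : R) : apx f -> 0 < d ->
  (forall z t, L z -> t0 <= t -> d <= cmod (f z - t%:C)) ->
  apx (fun z => (f z - t0%:C)^-1).
Proof.
move=> af d0 fd; have [B [B0 fB]] := apx_bounded af.
have half01 : 0 <= (1 / 2 : R) < 1 by lra.
have far (t : R) : 2 * B <= t -> apx (fun z => (f z - t%:C)^-1).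
  move=> tB; have tgt0 : 0 < t by lra.
  have tn0 : t%:C != 0 by rewrite -cmod_gt0 cmod_real gtr0_norm.
  have hb z : L z -> cmod (t%:C^-1 * f z) <= 1 / 2.
    move=> Lz; rewrite cmodM cmodV cmod_real gtr0_norm // mulrC.
    by rewrite ler_pdivrMr //; have := fB _ Lz; lra.
  have := apxZ (- t%:C^-1) (apx_invB1 (apxZ _ af) half01 hb).
  apply: apx_ext => z Lz; rewrite mulNr -invfM -invrN; congr (_^-1).
  by rewrite mulrBr mulr1 mulrA divff // mul1r opprB.
suff main n (t : R) : t0 <= t -> 2 * B <= t + n%:R * (d / 2) ->
    apx (fun z => (f z - t%:C)^-1).
  pose n := Num.bound (`|2 * B - t0| / (d / 2)).
  apply: (main n t0) => //.
  have : `|2 * B - t0| / (d / 2) < n%:R.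
    by rewrite archi_boundP // divr_ge0 //; lra.
  rewrite ltr_pdivrMr; last by lra.
  by have := ler_norm (2 * B - t0); lra.
elim: n t => [|n IH] t tt0 tB; first by apply: far; lra.
pose u := t + d / 2.
have au : apx (fun z => (f z - u%:C)^-1).
  apply: IH; rewrite /u; first by lra.
  by move: tB; rewrite -[n.+1%:R]natr1; lra.
have hb z : L z -> cmod (- (d / 2)%:C * (f z - u%:C)^-1) <= 1 / 2.
  move=> Lz; have dle : d <= cmod (f z - u%:C) by rewrite fd // /u; lra.
  rewrite cmodM cmodN cmod_real cmodV gtr0_norm ?divr_gt0 //.
  by rewrite ler_pdivrMr ?(lt_le_trans d0 dle) //; lra.
have := apxM au (apx_invB1 (apxZ (- (d / 2)%:C) au) half01 hb).
apply: apx_ext => z Lz; rewrite -invfM; congr (_^-1).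
have un0 : f z - u%:C != 0.
  by rewrite -cmod_gt0 (lt_le_trans d0) // fd // /u; lra.
rewrite mulrBr mulr1 mulrCA divff // mulr1 opprK /u rmorphD /=.
by rewrite opprD addrA addrNK.
Qed.

End UniformClosure.

(** * The sign function as a uniform limit of polynomials *)

Section NewtonSign.
Variable R : realType.
Local Notation C := R[i].

Lemma Re_inv (x : C) : Re x^-1 = Re x / cmod x ^+ 2.
Proof. by rewrite cmod_sqr; case: x. Qed.

Lemma ReD (x y : C) : Re (x + y) = Re x + Re y.
Proof. by case: x => a b; case: y. Qed.

Lemma ReN (x : C) : Re (- x) = - Re x.
Proof. by case: x. Qed.

Lemma ReZ (a : R) (x : C) : Re (a%:C * x) = a * Re x.
Proof. by case: x => b c /=; rewrite mul0r subr0. Qed.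

(** Newton's iteration for the square roots of 1; it converges to 1 on the
    right half-plane and to -1 on the left one. *)
Definition newton (x : C) : C := 2^-1%:C * (x + x^-1).

Lemma newtonN x : newton (- x) = - newton x.
Proof. by rewrite /newton invrN -opprD mulrN. Qed.

Lemma newton_Re x : 0 <= Re x -> Re x / 2 <= Re (newton x).
Proof.
move=> x0; rewrite /newton ReZ ReD Re_inv.
have : 0 <= Re x / cmod x ^+ 2 by rewrite divr_ge0 // exprn_ge0 // cmod_ge0.
by lra.
Qed.

Lemma Re_gt0_neq0 (x : C) : 0 < Re x -> x != 0.
Proof. by apply: contraTneq => ->; rewrite ltxx. Qed.

(** The Cayley transform [x |-> (x - 1) / (x + 1)] conjugates Newton's iteration
    to squaring. *)
Lemma newton_cayley x : 0 < Re x ->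
  (newton x - 1) / (newton x + 1) = ((x - 1) / (x + 1)) ^+ 2.
Proof.
move=> x0; have xn0 := Re_gt0_neq0 x0.
have x1n0 : x + 1 != 0 by apply: Re_gt0_neq0; rewrite ReD /=; lra.
have := newton_Re (ltW x0) => n1.
have : newton x + 1 != 0 by apply: Re_gt0_neq0; rewrite ReD /=; lra.
have -> : newton x + 1 = (x + 1) ^+ 2 / (2 * x).
  by rewrite /newton fmorphV rmorph_nat; field.
have -> : newton x - 1 = (x - 1) ^+ 2 / (2 * x).
  by rewrite /newton fmorphV rmorph_nat; field.
by move=> _; field; rewrite xn0 x1n0.
Qed.

(** The convergence is uniform on bounded sets at a positive distance from the
    imaginary axis, since the Cayley transform then takes values in a
    disc of radius less than 1. *)
Lemma newton_cvg (c B e : R) : 0 < c -> 0 < B -> 0 < e ->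
  exists k, forall x, c <= Re x -> cmod x <= B ->
    cmod (iter k newton x - 1) <= e.
Proof.
move=> c0 B0 e0; pose q : R := 1 - 4 * c / (B + 1) ^+ 2.
have B1 : 0 < (B + 1) ^+ 2 by rewrite exprn_gt0 // addr_gt0.
have q1 : q < 1 by rewrite gtrDl oppr_lt0 divr_gt0 // mulr_gt0.
have [q0|q0] := ltP q 0.
  (* then no point satisfies the two conditions *)
  exists 0%N => x cx xB; exfalso.
  have := normr_Re_le x; have := ler_norm (Re x) => h1 h2.
  move: q0; rewrite /q subr_lt0 ltr_pdivlMr // mul1r => q0.
  by have := sqr_ge0 (B - 1); lra.
pose d := Num.min 2^-1 (e / 4).
have d0 : 0 < d by rewrite lt_min invr_gt0 ltr0n divr_gt0.
have [|j jP] := @expr_lt_eps R q d _ d0; first by rewrite q0.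
exists j.+1 => x cx xB.
have key k : 0 < Re (iter k newton x) /\
    (iter k newton x - 1) / (iter k newton x + 1)
      = ((x - 1) / (x + 1)) ^+ (2 ^ k).
  elim: k => [|k [IH1 IH2]]; first by split => /=; [lra | rewrite expr1].
  split; first by have := newton_Re (ltW IH1); rewrite /=; lra.
  by rewrite /= newton_cayley // IH2 -exprM expnSr.
have [wpos] := key j.+1; set w := iter j.+1 newton x => wE.
have y2 : cmod ((x - 1) / (x + 1)) ^+ 2 <= q.
  have xp : 0 < cmod (x + 1) ^+ 2.
    rewrite exprn_gt0 // cmod_gt0; apply: Re_gt0_neq0.
    by rewrite ReD /=; lra.
  rewrite cmodM cmodV expr_div_n ler_pdivrMr // /q mulrBl mul1r.
  have -> : cmod (x - 1) ^+ 2 = cmod (x + 1) ^+ 2 - 4 * Re x.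
    by rewrite !cmod_sqr; case: (x) => a b /=; ring.
  rewrite lerD2l lerN2 mulrAC ler_pdivrMr //.
  have x1B : cmod (x + 1) <= B + 1.
    by rewrite (le_trans (cmodD _ _)) // cmod1 lerD2r.
  apply: ler_pM; rewrite ?mulr_ge0 ?exprn_ge0 ?cmod_ge0 ?(ltW c0) //.
    by rewrite ler_wpM2l.
  by rewrite lerXn2r ?nnegrE ?cmod_ge0 // ltW // addr_gt0.
set y := (w - 1) / (w + 1) in wE.
have yd : cmod y <= d.
  rewrite wE expnS exprM cmodX cmodX; apply: le_trans jP.
  have h : 0 <= cmod ((x - 1) / (x + 1)) ^+ 2 by rewrite exprn_ge0 // cmod_ge0.
  apply: le_trans (lerXn2r (2 ^ j) _ _ y2) _; rewrite ?nnegrE //.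
  by rewrite ler_wiXn2l // ?(ltW q1) // ltnW // ltn_expl.
have w1n0 : w + 1 != 0 by apply: Re_gt0_neq0; rewrite ReD /=; lra.
move: (yd); rewrite le_min => /andP[yd1 yd2].
have lb : 1 / 2 <= cmod (1 - y).
  by rewrite (le_trans _ (cmod_leB _ _)) // cmod1; lra.
have y1n0 : 1 - y != 0 by rewrite -cmod_gt0; lra.
have -> : w - 1 = 2 * y / (1 - y).
  apply: (mulIf y1n0); rewrite divfK // /y.
  by field.
move: y yd lb {wE yd1 y1n0} yd2 => y yd lb yd2.
rewrite !cmodM cmodV cmod_nat ler_pdivrMr; last by lra.
by have := cmod_ge0 y; nra.
Qed.

Variable L : C -> Prop.
Hypothesis L_le1 : forall z, L z -> cmod z <= 1.
Local Notation apx := (poly_approx L).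

Lemma apx_inv_Re f (c : R) : apx f -> 0 < c ->
  (forall z, L z -> c <= `|Re (f z)|) -> apx (fun z => (f z)^-1).
Proof.
move=> af c0 fc.
have h z t : L z -> 0 <= t -> c <= cmod (- 'i * f z - t%:C).
  move=> Lz _; apply: le_trans (fc _ Lz) _.
  apply: le_trans (normr_Im_le _); case: (f z) => a b /=.
  by rewrite oppr0 mul0r mulN1r add0r addr0 normrN.
have := apxZ L_le1 (- 'i) (apx_inv_ray L_le1 (apxZ L_le1 (- 'i) af) c0 h).
apply: apx_ext => z Lz; rewrite subr0 invfM mulrA divff ?mul1r //.
by rewrite oppr_eq0 -cmod_eq0 cmodi oner_eq0.
Qed.

Lemma apx_sign f (c : R) (A : pred C) : apx f -> 0 < c ->
  (forall z, L z -> A z -> c <= Re (f z)) ->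
  (forall z, L z -> ~~ A z -> Re (f z) <= - c) ->
  apx (fun z => (A z)%:R).
Proof.
move=> af c0 fA fN.
suff sgn : apx (fun z => if A z then 1 else - 1).
  have := apxZ L_le1 2^-1 (apxD sgn (apx_cst L 1)).
  apply: apx_ext => z Lz; case: (A z); last by rewrite addNr mulr0.
  by rewrite mulVf // pnatr_eq0.
apply: apx_lim => e e0.
have [B [B0 fB]] := apx_bounded L_le1 af.
have [k kP] := newton_cvg c0 B0 e0.
have iterN n x : iter n newton (- x) = - iter n newton x.
  by elim: n => //= n ->; rewrite newtonN.
exists (fun z => iter k newton (f z)); split; last first.
  move=> z Lz; case: ifPn => Az; first by rewrite cmodBC kP ?fA ?fB.
  rewrite addrC -iterN kP ?cmodN ?fB // ReN.
  by have := fN _ Lz Az; lra.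
elim: {kP} k => //= k IH.
have [c' [c'0 c'A c'N]] : exists c' : R, [/\ 0 < c',
    forall z, L z -> A z -> c' <= Re (iter k newton (f z)) &
    forall z, L z -> ~~ A z -> Re (iter k newton (f z)) <= - c'].
  elim: {IH} k => [|k [d [d0 dA dN]]]; first by exists c.
  exists (d / 2); split=> [|z Lz Az|z Lz Az] /=; first by rewrite divr_gt0.
    have := dA _ Lz Az => h; have := @newton_Re (iter k newton (f z)).
    by move=> /(_ (ltW (lt_le_trans d0 h))); lra.
  have := dN _ Lz Az => h; have := @newton_Re (- iter k newton (f z)).
  rewrite newtonN !ReN => /(_ _); lra.
have ai : apx (fun z => (iter k newton (f z))^-1).
  apply: apx_inv_Re IH c'0 _ => z Lz.
  case: (boolP (A z)) => Az.
    by rewrite (le_trans (c'A z Lz Az)) // ler_norm.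
  by rewrite -normrN (le_trans _ (ler_norm _)) //; have := c'N z Lz Az; lra.
exact: (apxZ L_le1 _ (apxD IH ai)).
Qed.

End NewtonSign.

(** * Separating a disc from an arc of a larger circle *)

Section DiscAndArc.
Variable R : realType.
Local Notation C := R[i].

Lemma poly_approx_sub (L L' : C -> Prop) f :
  (forall z, L' z -> L z) -> poly_approx L f -> poly_approx L' f.
Proof.
by move=> LL' af e e0; have [p fp] := af e e0; exists p => z /LL'; exact: fp.
Qed.

(** The distance from [q] to the ray [[1, +oo[] when [q] is unimodular is
    attained at 1. *)
Lemma cmodB1_le_ray (q : C) (t : R) : cmod q = 1 -> 1 <= t ->
  cmod (q - 1) <= cmod (q - t%:C).
Proof.
move=> q1 t1; rewrite -(@ler_pXn2r _ 2) // ?nnegrE ?cmod_ge0 //.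
have := normr_Re_le q; rewrite q1 !cmod_sqr.
by case: q {q1} => a b /= /ler_normlP[_ a1]; nra.
Qed.

Lemma Re_cayley (q : C) : q != 1 ->
  Re (1 + 2 * (q - 1)^-1) = (cmod q ^+ 2 - 1) / cmod (q - 1) ^+ 2.
Proof.
rewrite -subr_eq0 => q1; have q1' : cmod (q - 1) ^+ 2 != 0.
  by rewrite expf_eq0 /= cmod_eq0.
have -> : 2 = 2%:C :> C by rewrite rmorph_nat.
rewrite ReD ReZ Re_inv /=; apply: (mulIf q1').
rewrite divfK // mulrDl mul1r -mulrA divfK // !cmod_sqr.
by case: q {q1 q1'} => a b /=; ring.
Qed.

Variables (s r d : R) (zeta : C).
Hypotheses (s0 : 0 <= s) (sr : s < r) (r1 : r <= 1).
Hypotheses (d0 : 0 < d) (zeta1 : cmod zeta = 1).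

(** The disc of radius [s] together with the circle of radius [r], without a
    neighbourhood of its point in the direction of [zeta]. *)
Definition disc_arc (z : C) : Prop :=
  cmod z <= s \/ cmod z = r /\ d <= cmod (z - r%:C * zeta).

Let w (z : C) : C := (r%:C * zeta)^-1 * z.

Let r0 : 0 < r. Proof. exact: le_lt_trans sr. Qed.

Let rz : cmod (r%:C * zeta) = r.
Proof. by rewrite cmodM cmod_real zeta1 mulr1 gtr0_norm. Qed.

Let rz0 : r%:C * zeta != 0.
Proof. by rewrite -cmod_gt0 rz. Qed.

Let cmodw z : cmod (w z) = cmod z / r.
Proof. by rewrite cmodM cmodV rz mulrC. Qed.

Let cmodw1 z : cmod (w z - 1) = cmod (z - r%:C * zeta) / r.
Proof.
rewrite -{2}rz -cmodV -cmodM; congr cmod.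
by rewrite mulrBl divff // mulrC.
Qed.

Lemma disc_arc_le1 z : disc_arc z -> cmod z <= 1.
Proof.
case=> [h|[h _]]; first by rewrite (le_trans h) // (le_trans (ltW sr)).
by rewrite h.
Qed.

(** The Cayley transform sending the circle of radius [r] to the imaginary
    axis and its point in the direction of [zeta] to infinity. *)
Definition arc_cayley (z : C) : C := 1 + 2 * (w z - 1)^-1.

Lemma disc_arc_gap :
  exists2 d' : R, 0 < d' & forall z t, disc_arc z -> 1 <= t ->
    d' <= cmod (w z - t%:C).
Proof.
have sr1 : s / r < 1 by rewrite ltr_pdivrMr // mul1r.
exists (Num.min (1 - s / r) (d / r)).
  by rewrite lt_min subr_gt0 sr1 divr_gt0.
move=> z t [zs|[zr zd]] t1; rewrite ge_min; apply/orP; [left|right].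
  rewrite cmodBC (le_trans _ (cmod_leB _ _)) // cmod_real cmodw.
  apply: lerB; first by rewrite (le_trans t1) // ler_norm.
  by rewrite ler_pM2r // invr_gt0.
apply: le_trans (cmodB1_le_ray _ t1); last by rewrite cmodw zr divff ?gt_eqF.
by rewrite cmodw1 ler_pM2r // invr_gt0.
Qed.

Lemma disc_arc_neq1 z : disc_arc z -> w z != 1.
Proof.
move=> Lz; have [d' d'0 gap] := disc_arc_gap.
by rewrite -subr_eq0 -cmod_gt0 (lt_le_trans d'0) // gap.
Qed.

Lemma apx_arc_cayley : poly_approx disc_arc arc_cayley.
Proof.
have [d' d'0 gap] := disc_arc_gap.
have aw : poly_approx disc_arc w by apply: (apxZ disc_arc_le1); exact: apx_id.
have := apx_inv_ray disc_arc_le1 aw d'0 gap.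
move=> /(apxZ disc_arc_le1 2)/(apxD (apx_cst _ 1)).
by apply: apx_ext => z _.
Qed.

Lemma Re_arc_cayley_arc z : cmod z = r -> d <= cmod (z - r%:C * zeta) ->
  Re (arc_cayley z) = 0.
Proof.
move=> zr zd; rewrite Re_cayley; last by apply: disc_arc_neq1; right.
by rewrite cmodw zr divff ?gt_eqF // expr1n subrr mul0r.
Qed.

Lemma Re_arc_cayley_disc z : cmod z <= s ->
  Re (arc_cayley z) <= - ((1 - (s / r) ^+ 2) / 4).
Proof.
move=> zs; have w1 : w z != 1 by apply: disc_arc_neq1; left.
have sr1 : s / r < 1 by rewrite ltr_pdivrMr // mul1r.
have ws : cmod (w z) <= s / r by rewrite cmodw ler_pM2r // invr_gt0.
have sr0 : 0 <= s / r by rewrite divr_ge0 // ltW.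
have wge0 := cmod_ge0 (w z).
rewrite Re_cayley // -opprB mulNr lerN2.
have n0 : 0 < cmod (w z - 1) by rewrite cmod_gt0 subr_eq0.
have le2 : cmod (w z - 1) <= 2.
  by rewrite (le_trans (cmodB _ _)) // cmod1; lra.
have h1 : 1 - (s / r) ^+ 2 <= 1 - cmod (w z) ^+ 2.
  by rewrite lerB // lerXn2r // nnegrE.
have h2 : 0 <= 1 - (s / r) ^+ 2 by nra.
rewrite ler_pM ?invr_ge0 // lef_pV2 ?posrE ?exprn_gt0 //.
by nra.
Qed.

(** A polynomial close to the indicator function of the arc. *)
Lemma disc_arc_separation (e : R) : 0 < e ->
  exists p : {poly C}, (forall z, cmod z <= s -> cmod p.[z] <= e) /\
    forall z, cmod z = r -> d <= cmod (z - r%:C * zeta) ->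
      cmod (p.[z] - 1) <= e.
Proof.
move=> e0; pose c : R := (1 - (s / r) ^+ 2) / 8.
have sr1 : s / r < 1 by rewrite ltr_pdivrMr // mul1r.
have sr0 : 0 <= s / r by rewrite divr_ge0 // ltW.
have c0 : 0 < c by rewrite /c divr_gt0 //; nra.
have ac := apxD apx_arc_cayley (apx_cst disc_arc c%:C).
have chi : poly_approx disc_arc (fun z => (s < cmod z)%R%:R).
  apply: (apx_sign disc_arc_le1 ac c0) => z [zs|[zr zd]].
  - by rewrite ltNge zs.
  - by move=> _; rewrite ReD Re_arc_cayley_arc //= add0r.
  - by move=> _; rewrite ReD /=; have := Re_arc_cayley_disc zs; rewrite /c; lra.
  - by rewrite zr sr.
have [p pP] := chi _ e0.
exists p; split=> [z zs|z zr zd].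
  have := pP z (or_introl zs).
  by rewrite ltNge zs /= add0r cmodN.
by have := pP z (or_intror (conj zr zd)); rewrite zr sr cmodBC.
Qed.

End DiscAndArc.

(** * Density of the polynomials in the continuous functions on an arc *)

(** The Bernstein polynomial
    [\sum_(k <= n) 'C(n, k) * x ^+ k * (1 - x) ^+ (n - k) * g k],
    by recursion on [n]: the mean of [g] under a binomial law, computed by
    conditioning on the first trial. *)
Fixpoint bernstein (F : comNzRingType) n (g : nat -> F) (x : F) : F :=
  if n is m.+1 then
    x * bernstein m (fun k => g k.+1) x + (1 - x) * bernstein m g x
  else g 0%N.

Section Bernstein.
Variable R : realType.
Local Notation C := R[i].

Lemma bernstein_le n (g h : nat -> R) x : 0 <= x <= 1 ->
  (forall k, g k <= h k) -> bernstein n g x <= bernstein n h x.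
Proof.
move=> /andP[x0 x1]; elim: n g h => [|n IH] g h gh /=; first exact: gh.
by rewrite lerD // ler_wpM2l ?subr_ge0 // IH.
Qed.

Lemma bernstein_moment2 n (a b c x : R) :
  bernstein n (fun k => a + b * (k%:R - c) ^+ 2) x =
  a + b * (n%:R * x * (1 - x) + (n%:R * x - c) ^+ 2).
Proof.
elim: n c => [|n IH] c /=; first by ring.
have -> : (fun k => a + b * (k.+1%:R - c) ^+ 2) =
          (fun k : nat => a + b * (k%:R - (c - 1)) ^+ 2).
  by apply: funext => k; rewrite -[k.+1%:R]natr1 opprB addrA.
by rewrite !IH -[n.+1%:R]natr1; ring.
Qed.

Lemma bernstein_dist n (g : nat -> C) (v : C) (x : R) : 0 <= x <= 1 ->
  cmod (bernstein n g x%:C - v) <= bernstein n (fun k => cmod (g k - v)) x.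
Proof.
move=> /andP[x0 x1]; elim: n g => [|n IH] g //=.
have -> : x%:C * bernstein n (fun k => g k.+1) x%:C
    + (1 - x%:C) * bernstein n g x%:C - v =
    x%:C * (bernstein n (fun k => g k.+1) x%:C - v)
    + (1 - x)%:C * (bernstein n g x%:C - v).
  by rewrite rmorphB rmorph1; ring.
rewrite (le_trans (cmodD _ _)) // !cmodM !cmod_real !ger0_norm ?subr_ge0 //.
by rewrite lerD // ler_wpM2l ?subr_ge0 // IH.
Qed.

Lemma apx_bernstein (L : C -> Prop) n (g : nat -> C) f :
  (forall z, L z -> cmod z <= 1) -> poly_approx L f ->
  poly_approx L (fun z => bernstein n g (f z)).
Proof.
move=> L1 af; elim: n g => [|n IH] g /=; first exact: apx_cst.
apply: apxD; apply: (apxM L1) => //.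
have := apxD (apx_cst L 1) (apxZ L1 (-1) af).
by apply: apx_ext => z _; rewrite mulN1r.
Qed.

Variables (K : C -> Prop) (zeta : C) (d : R).
Hypotheses (zeta1 : cmod zeta = 1) (d0 : 0 < d).
Hypothesis KP : forall z, K z -> cmod z = 1 /\ d <= cmod (z - zeta).

Let X := arc_cayley 1 zeta.

Let K1 z : K z -> cmod z <= 1. Proof. by case/KP => ->. Qed.

Let K_disc_arc z : K z -> disc_arc 0 1 d zeta z.
Proof. by case/KP => z1 zd; right; rewrite mul1r. Qed.

Let apxX : poly_approx K X.
Proof.
apply: poly_approx_sub K_disc_arc _.
exact: apx_arc_cayley.
Qed.

Let ReX z : K z -> Re (X z) = 0.
Proof.
case/KP => z1 zd; rewrite /X (@Re_arc_cayley_arc _ 0 1 d) ?mul1r //.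
Qed.

(** On the arc, [z] is a Lipschitz function of its Cayley transform. *)
Lemma arc_cayley_expanding z z' : K z -> K z' ->
  cmod (z - z') <= 2 * `|Im (X z) - Im (X z')|.
Proof.
move=> Kz Kz'.
have zeta0 : zeta != 0 by rewrite -cmod_gt0 zeta1.
have neq1 y : K y -> zeta^-1 * y - 1 != 0.
  move=> Ky; have := KP Ky => -[_ yd].
  have -> : zeta^-1 * y - 1 = zeta^-1 * (y - zeta) by rewrite mulrBr mulVf.
  by rewrite mulf_neq0 ?invr_eq0 // -cmod_gt0 (lt_le_trans d0).
have XB1 y : K y -> X y - 1 = 2 * (zeta^-1 * y - 1)^-1.
  by move=> Ky; rewrite /X /arc_cayley mul1r addrC addKr.
have XB1_ge1 y : K y -> 1 <= cmod (X y - 1).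
  move=> Ky; apply: le_trans (normr_Re_le _); rewrite ReD ReX //= add0r.
  by rewrite normrN normr1.
have XB1n0 y : K y -> X y - 1 != 0.
  by move=> Ky; rewrite -cmod_gt0 (lt_le_trans ltr01) // XB1_ge1.
have yE y : K y -> y = zeta * (1 + 2 / (X y - 1)).
  move=> Ky; rewrite XB1 // invfM invrK mulrA divff ?pnatr_eq0 // mul1r.
  by rewrite addrC subrK mulrA divff // mul1r.
have zB : z - z' = zeta * (2 * (X z' - X z) / ((X z - 1) * (X z' - 1))).
  rewrite {1}(yE _ Kz) {1}(yE _ Kz'); field.
  by rewrite XB1n0 // XB1n0.
rewrite zB !cmodM zeta1 mul1r cmodV cmodM cmod_nat.
have -> : cmod (X z' - X z) = `|Im (X z) - Im (X z')|.
  have := ReX Kz; have := ReX Kz'; rewrite /cmod.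
  case: (X z) => a b; case: (X z') => a' b' /= -> ->.
  by rewrite subr0 expr0n add0r sqrtr_sqr distrC.
rewrite ler_piMr ?mulr_ge0 // invf_le1; last first.
  by rewrite mulr_gt0 // (lt_le_trans ltr01) // XB1_ge1.
by rewrite -[1]mulr1 ler_pM // XB1_ge1.
Qed.

(** Bernstein approximation in the variable [Im (X z)], which lies in a compact
    interval; the values of [f] are sampled on [K] at points close to the nodes
    whenever there is one. *)
Theorem poly_dense_arc f :
  (forall e : R, 0 < e -> exists2 eta : R, 0 < eta &
     forall z z', K z -> K z' -> cmod (z - z') <= eta ->
       cmod (f z - f z') <= e) ->
  (exists M : R, forall z, K z -> cmod (f z) <= M) ->
  poly_approx K f.
Proof.
move=> uf [M0 fM0]; apply: apx_lim => e e0.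
pose M : R := `|M0| + 1.
have M1 : 0 < M by rewrite ltr_wpDl.
have fM z : K z -> cmod (f z) <= M.
  by move=> /fM0 h; rewrite (le_trans h) // (le_trans (ler_norm _)) // lerDl.
have [B [B0 XB]] := apx_bounded K1 apxX.
have [eta eta0 fu] := uf (e / 2) (divr_gt0 e0 (ltr0Sn _ _)).
pose x z : R := (Im (X z) + B) / (2 * B).
have B2 : 0 < 2 * B by rewrite mulr_gt0.
have x01 z : K z -> 0 <= x z <= 1.
  move=> Kz; have := le_trans (normr_Im_le _) (XB _ Kz).
  rewrite ler_norml /x => /andP[h1 h2].
  by rewrite ler_pdivlMr // ler_pdivrMr // mul0r mul1r; lra.
pose w z : C := (2 * B)^-1%:C * (- 'i * X z + B%:C).
have wE z : K z -> w z = (x z)%:C.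
  move=> Kz; rewrite /w /x [(Im _ + B) / _]mulrC rmorphM /=; congr (_ * _).
  rewrite rmorphD; congr (_ + _); have := ReX Kz.
  case: (X z) => a b /= ->.
  by apply/eqP; rewrite eq_complex /=; apply/andP; split; apply/eqP; ring.
have aw : poly_approx K w.
  by apply: (apxZ K1); apply: apxD (apx_cst _ _); exact: (apxZ K1).
pose th : R := eta / (8 * B).
have th0 : 0 < th by rewrite divr_gt0 // mulr_gt0.
have [[Mge0 thge0] ege0] := (ltW M1, ltW th0, ltW e0).
have [n nP] : exists n : nat, 4 * M / (th ^+ 2 * e) < n%:R.
  exists (Num.bound (4 * M / (th ^+ 2 * e))); apply: archi_boundP.
  by apply: divr_ge0; apply: mulr_ge0 => //; exact: exprn_ge0.
have n0 : 0 < n%:R :> R.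
  apply: le_lt_trans nP.
  by apply: divr_ge0; apply: mulr_ge0 => //; exact: exprn_ge0.
have /choice[g gP] : forall k : nat, exists v : C, cmod v <= M /\
    forall z, K z -> `|x z - k%:R / n%:R| <= th -> cmod (v - f z) <= e / 2.
  move=> k; have [[y [Ky yk]]|no] :=
    pselect (exists y, K y /\ `|x y - k%:R / n%:R| <= th).
    exists (f y); split=> [|z Kz zk]; first exact: fM.
    apply: fu => //; apply: le_trans (arc_cayley_expanding Ky Kz) _.
    have -> : Im (X y) - Im (X z) = 2 * B * (x y - x z).
      by rewrite /x; field; rewrite gt_eqF.
    rewrite normrM gtr0_norm //.
    have : `|x y - x z| <= 2 * th.
      have -> : x y - x z = (x y - k%:R / n%:R) - (x z - k%:R / n%:R) by ring.
      by rewrite (le_trans (ler_normB _ _)) //; lra.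
    have -> : eta = 2 * (2 * B * (2 * th)).
      by rewrite /th; field; rewrite gt_eqF.
    by move=> h; rewrite ler_wpM2l // ler_wpM2l // ltW.
  exists 0; split=> [|z Kz zk]; first by rewrite cmod0 ltW.
  by exfalso; apply: no; exists z.
exists (fun z => bernstein n g (w z)); split; first exact: apx_bernstein.
move=> z Kz; rewrite cmodBC wE //.
apply: le_trans (bernstein_dist _ _ _ (x01 _ Kz)) _.
pose A : R := 2 * M / (th ^+ 2 * n%:R ^+ 2).
have A0 : 0 < A by apply: divr_gt0; apply: mulr_gt0 => //; exact: exprn_gt0.
apply: (@le_trans _ _
  (bernstein n (fun k => e / 2 + A * (k%:R - n%:R * x z) ^+ 2) (x z))).
  apply: bernstein_le; first exact: x01.
  move=> k; have [gM gf] := gP k.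
  have sq0 : 0 <= A * (k%:R - n%:R * x z) ^+ 2.
    by rewrite mulr_ge0 ?sqr_ge0 // ltW.
  have [near|far] := leP `|x z - k%:R / n%:R| th.
    by have := gf _ Kz near; lra.
  apply: (@le_trans _ _ (2 * M)).
    by rewrite (le_trans (cmodB _ _)) //; have := fM _ Kz; lra.
  have -> : A * (k%:R - n%:R * x z) ^+ 2 =
      2 * M * (`|x z - k%:R / n%:R| ^+ 2 / th ^+ 2).
    rewrite real_normK ?num_real // /A; field.
    by rewrite !gt_eqF.
  have : 1 <= `|x z - k%:R / n%:R| ^+ 2 / th ^+ 2.
    by rewrite ler_pdivlMr ?exprn_gt0 // mul1r lerXn2r // ?nnegrE // ltW.
  by move=> h; have : 2 * M <= 2 * M * (`|x z - k%:R / n%:R| ^+ 2 / th ^+ 2);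
    [rewrite ler_peMr // mulr_ge0 // ltW | lra].
rewrite bernstein_moment2 subrr expr0n addr0.
have -> : A * (n%:R * x z * (1 - x z)) =
    (2 * M / (th ^+ 2 * n%:R)) * (x z * (1 - x z)).
  by rewrite /A; field; rewrite !gt_eqF.
have xx : x z * (1 - x z) <= 1 by have /andP[? ?] := x01 _ Kz; nra.
have hA : 2 * M / (th ^+ 2 * n%:R) <= e / 2.
  have tn0 : 0 < th ^+ 2 * n%:R by apply: mulr_gt0 => //; exact: exprn_gt0.
  have te0 : 0 < th ^+ 2 * e by apply: mulr_gt0 => //; exact: exprn_gt0.
  by move: nP; rewrite ler_pdivrMr // ltr_pdivrMr //; lra.
have hA0 : 0 <= 2 * M / (th ^+ 2 * n%:R).
  by apply: divr_ge0; apply: mulr_ge0 => //; exact: exprn_ge0.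
have := ler_wpM2l hA0 xx; lra.
Qed.

End Bernstein.

(** * Cauchy estimates for polynomials *)

Section CauchyEstimates.
Variable R : realType.
Local Notation C := R[i].

Lemma complex_prim_root_exists n : (0 < n)%N ->
  exists w : C, n.-primitive_root w.
Proof.
move=> n0; have [rs rsE] := closed_field_poly_normal ('X^n - 1 : {poly C}).
rewrite (monicP _) ?monicXnsubC // scale1r in rsE.
have rs1 : all n.-unity_root rs.
  by apply/allP=> z; rewrite -root_prod_XsubC -rsE.
have szrs : (n < (size rs).+1)%N.
  by rewrite -(size_prod_XsubC rs id) -rsE size_XnsubC.
have [|z] := hasP (has_prim_root n0 rs1 _ szrs); last by exists z.
by rewrite -separable_prod_XsubC -rsE separable_Xn_sub_1 // pnatr_eq0 -lt0n.
Qed.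

(** The coefficient is recovered by averaging over the circle of radius [rho]
    sampled at the roots of unity of a large order. *)
Lemma cauchy_coef (p : {poly C}) (rho M : R) k : 0 < rho ->
  (forall z, cmod z = rho -> cmod p.[z] <= M) -> cmod p`_k * rho ^+ k <= M.
Proof.
move=> rho0 pM; have M0 : 0 <= M.
  by apply: le_trans (pM rho%:C _); rewrite ?cmod_ge0 // cmod_real gtr0_norm.
pose n := (size p + k).+1.
have [w prw] := @complex_prim_root_exists n isT.
have wn : w ^+ n = 1 := prim_expr_order prw.
have w1 : cmod w = 1.
  apply/eqP; rewrite -(@pexpr_eq1 _ _ n) ?cmod_ge0 //.
  by rewrite -cmodX wn cmod1.
have w0 : w != 0 by rewrite -cmod_gt0 w1.
have avg : \sum_(j < n) p.[rho%:C * w ^+ j] * (w ^+ k)^-1 ^+ j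
    = n%:R * (p`_k * rho%:C ^+ k).
  under eq_bigr => j _.
    rewrite (@horner_coef_wide _ n) ?leqW ?leq_addr // mulr_suml.
    under eq_bigr => i _.
      rewrite exprMn -!mulrA -exprM mulnC exprM -exprMn.
    over.
  over.
  rewrite exchange_big /=.
  have kn : (k < n)%N by rewrite ltnS leq_addl.
  rewrite (bigD1 (Ordinal kn)) //= [X in _ + X]big1 ?addr0.
    rewrite -!mulr_sumr divff ?expf_neq0 //.
    under eq_bigr => j _ do rewrite expr1n.
    by rewrite sumr_const card_ord mulrA mulr_natr mulr_natl.
  move=> i /eqP ik; rewrite -!mulr_sumr.
  set y := w ^+ i / w ^+ k.
  have yn : y ^+ n = 1.
    by rewrite exprMn exprVn -!exprM ![(_ * n)%N]mulnC !exprM wn !expr1n divr1.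
  have y1 : y - 1 != 0.
    rewrite subr_eq0; apply/eqP => y1; apply: ik; apply: val_inj => /=.
    have : w ^+ i == w ^+ k.
      by rewrite -[w ^+ k]mul1r -y1 divfK // expf_neq0.
    rewrite (eq_prim_root_expr prw) !modn_small // => /eqP //.
  have -> : \sum_(j < n) y ^+ j = 0.
    by apply: (mulfI y1); rewrite -subrX1 yn subrr mulr0.
  by rewrite !mulr0.
have nn0 : 0 < n%:R :> R by rewrite ltr0n.
rewrite -(ler_pM2l nn0).
have -> : n%:R * (cmod p`_k * rho ^+ k) = cmod (n%:R * (p`_k * rho%:C ^+ k)).
  by rewrite !cmodM cmodX cmod_nat cmod_real (gtr0_norm rho0).
rewrite -avg (le_trans (cmod_sum _ _)) //.
apply: (@le_trans _ _ (\sum_(j < n) M)); last first.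
  by rewrite sumr_const card_ord mulr_natl.
apply: ler_sum => j _; rewrite cmodM cmodX cmodV cmodX w1 expr1n invr1 expr1n.
by rewrite mulr1 pM // cmodM cmodX w1 expr1n mulr1 cmod_real gtr0_norm.
Qed.

Lemma horner_shift (p : {poly C}) (z h : C) :
  (p \Po ('X + z%:P)).[h] = p.[z + h].
Proof. by rewrite horner_comp hornerD hornerX hornerC addrC. Qed.

Lemma coef1_shift (p : {poly C}) (z : C) :
  (p \Po ('X + z%:P))`_1 = p^`().[z].
Proof.
have -> : forall q : {poly C}, q`_1 = q^`().[0].
  by move=> q; rewrite horner_coef0 coef_deriv mulr1n.
by rewrite deriv_comp derivD derivX derivC addr0 mulr1 horner_shift addr0.
Qed.

Lemma cauchy_deriv (p : {poly C}) (z : C) (rho M : R) : 0 < rho ->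
  (forall y, cmod (y - z) <= rho -> cmod p.[y] <= M) ->
  cmod p^`().[z] <= M / rho.
Proof.
move=> rho0 pM; rewrite -coef1_shift ler_pdivlMr // -[X in _ * X]expr1.
apply: cauchy_coef => // h hrho; rewrite horner_shift pM //.
by rewrite addrC addKr hrho.
Qed.

Lemma cauchy_remainder (p : {poly C}) (z h : C) (rho M : R) : 0 < rho ->
  (forall y, cmod (y - z) <= rho -> cmod p.[y] <= M) ->
  cmod h <= rho / 2 ->
  cmod (p.[z + h] - p.[z] - h * p^`().[z]) <= 2 * M / rho ^+ 2 * cmod h ^+ 2.
Proof.
move=> rho0 pM hrho; set q := p \Po ('X + z%:P).
have qM k : cmod q`_k <= M / rho ^+ k.
  rewrite ler_pdivlMr ?exprn_gt0 //; apply: cauchy_coef => // y yrho.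
  by rewrite horner_shift pM // addrC addKr yrho.
have M0 : 0 <= M.
  by apply: le_trans (pM z _); rewrite ?cmod_ge0 // subrr cmod0 ltW.
pose t := cmod h / rho.
have t0 : 0 <= t by rewrite divr_ge0 ?cmod_ge0 // ltW.
have t1 : t <= 1 / 2 by rewrite ler_pdivrMr //; lra.
have -> : p.[z + h] - p.[z] - h * p^`().[z]
    = \sum_(k < size q) q`_k.+2 * h ^+ k.+2.
  have -> : p.[z] = q`_0 by rewrite -horner_coef0 /q horner_shift addr0.
  rewrite -horner_shift -coef1_shift -/q.
  rewrite (@horner_coef_wide _ (size q).+2); last by rewrite !leqW.
  rewrite !big_ord_recl /= expr0 mulr1 expr1.
  have -> : forall a b c : C, a + (b * h + c) - a - h * b = c.
    by move=> a b c; ring.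
  exact: eq_bigr.
have geo n : \sum_(k < n) t ^+ k <= 2 - 2 * t ^+ n.
  elim: n => [|n IH]; first by rewrite big_ord0 expr0; lra.
  rewrite big_ord_recr /= exprS.
  have : 0 <= t ^+ n * (1 - 2 * t) by rewrite mulr_ge0 ?exprn_ge0 //; lra.
  by lra.
apply: le_trans (cmod_sum _ _) _.
apply: (@le_trans _ _ (M * t ^+ 2 * \sum_(k < size q) t ^+ k)).
  rewrite mulr_sumr; apply: ler_sum => k _.
  have -> : M * t ^+ 2 * t ^+ k = M / rho ^+ k.+2 * cmod h ^+ k.+2.
    by rewrite -mulrA -exprD /t expr_div_n mulrA mulrAC.
  rewrite cmodM cmodX.
  by rewrite ler_wpM2r // exprn_ge0 // cmod_ge0.
have -> : 2 * M / rho ^+ 2 * cmod h ^+ 2 = M * t ^+ 2 * 2.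
  by rewrite /t; field; rewrite gt_eqF.
apply: ler_wpM2l; first by rewrite mulr_ge0 // exprn_ge0.
by apply: le_trans (geo _) _; rewrite gerBl mulr_ge0 // exprn_ge0.
Qed.

End CauchyEstimates.

(** * Series of polynomials converging normally on smaller discs *)

Section NormalSeries.
Variable R : realType.
Local Notation C := R[i].

(** The series with general term [u] converges and its sum is [S]. *)
Definition sums_to (u : nat -> C) (S : C) : Prop :=
  forall e : R, 0 < e ->
  exists N, forall n, (N <= n)%N -> cmod (S - \sum_(j < n) u j) <= e.

Lemma sums_toB u v S T : sums_to u S -> sums_to v T ->
  sums_to (fun j => u j - v j) (S - T).
Proof.
move=> uS vT e e0; have e2 : 0 < e / 2 by rewrite divr_gt0.
have [N NP] := uS _ e2; have [N' NP'] := vT _ e2.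
exists (maxn N N') => n; rewrite geq_max => /andP[h1 h2].
have -> : S - T - \sum_(j < n) (u j - v j) =
    (S - \sum_(j < n) u j) - (T - \sum_(j < n) v j).
  by rewrite sumrB; ring.
by rewrite (le_trans (cmodB _ _)) //; have := NP _ h1; have := NP' _ h2; lra.
Qed.

Lemma sums_toZ (c : C) u S : sums_to u S -> sums_to (fun j => c * u j) (c * S).
Proof.
move=> uS e e0.
have c1 : 0 < cmod c + 1 by rewrite ltr_wpDl ?cmod_ge0.
have [N NP] := uS _ (divr_gt0 e0 c1).
exists N => n Nn; rewrite -mulr_sumr -mulrBr cmodM.
apply: (@le_trans _ _ ((cmod c + 1) * (e / (cmod c + 1)))).
  by rewrite ler_pM ?cmod_ge0 ?NP // lerDl.
by rewrite mulrC divfK // gt_eqF.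
Qed.

Lemma geometric_tail (u : nat -> C) (A : R) n m :
  (forall j, (n <= j)%N -> cmod (u j) <= A * 2^-1 ^+ j) -> (n <= m)%N ->
  cmod (\sum_(j < m) u j - \sum_(j < n) u j)
    <= 2 * A * 2^-1 ^+ n - 2 * A * 2^-1 ^+ m.
Proof.
move=> uA nm; rewrite -(subnKC nm); elim: (m - n)%N => [|k IH].
  by rewrite addn0 !subrr cmod0.
rewrite addnS big_ord_recr /= addrAC (le_trans (cmodD _ _)) //.
by have := uA (n + k)%N (leq_addr _ _); rewrite exprS; lra.
Qed.

Lemma sums_to_tail (u : nat -> C) (S : C) (A : R) n : sums_to u S ->
  (forall j, (n <= j)%N -> cmod (u j) <= A * 2^-1 ^+ j) ->
  cmod (S - \sum_(j < n) u j) <= 2 * A * 2^-1 ^+ n.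
Proof.
move=> uS uA; apply/ler_addgt0Pr => e e0; have [N NP] := uS _ e0.
pose m := maxn N n; have nm : (n <= m)%N by rewrite leq_maxr.
have A0 : 0 <= A * 2^-1 ^+ m by apply: le_trans (uA m nm); exact: cmod_ge0.
have -> : S - \sum_(j < n) u j = (S - \sum_(j < m) u j) +
    (\sum_(j < m) u j - \sum_(j < n) u j) by ring.
rewrite (le_trans (cmodD _ _)) //.
by have := NP m (leq_maxl _ _); have := geometric_tail uA nm; lra.
Qed.

(** The limit is obtained as the supremum of the lower bounds
    [a n - A * 2^-1 ^+ n]. *)
Lemma cauchy_geometric_limit (a : nat -> R) (A : R) :
  (forall n m, (n <= m)%N -> `|a m - a n| <= A * 2^-1 ^+ n) ->
  exists S : R, forall n, `|S - a n| <= A * 2^-1 ^+ n.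
Proof.
move=> aA; pose E : set R := fun y => exists n, y = a n - A * 2^-1 ^+ n.
have ub m : ubound E (a m + A * 2^-1 ^+ m).
  move=> _ [n ->]; have [nm|/ltnW mn] := leqP n m.
    have := aA _ _ nm; have := aA _ _ (leqnn m); rewrite subrr normr0.
    by move=> ? /ler_normlP[]; lra.
  have := aA _ _ mn; have := aA _ _ (leqnn n); rewrite subrr normr0.
  by move=> ? /ler_normlP[]; lra.
have E0 : nonempty E by exists (a 0%N - A * 2^-1 ^+ 0); exists 0%N.
exists (sup E) => n; have h1 : sup E <= a n + A * 2^-1 ^+ n by exact: ge_sup.
have h2 : a n - A * 2^-1 ^+ n <= sup E.
  by apply: ub_le_sup; [exists (a 0%N + A * 2^-1 ^+ 0); exact: ub | exists n].
by apply/ler_normlP; split; lra.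
Qed.

Lemma sums_to_exists (u : nat -> C) (A : R) :
  (forall j, cmod (u j) <= A * 2^-1 ^+ j) -> exists S, sums_to u S.
Proof.
move=> uA.
have tail n m : (n <= m)%N ->
    cmod (\sum_(j < m) u j - \sum_(j < n) u j) <= 2 * A * 2^-1 ^+ n.
  move=> nm; apply: le_trans (geometric_tail _ nm) _ => [j _|]; first exact: uA.
  by have := le_trans (cmod_ge0 _) (uA m); lra.
have A0 : 0 <= A by have := le_trans (cmod_ge0 _) (uA 0%N); rewrite expr0 mulr1.
have [|a aP] :=
    @cauchy_geometric_limit (fun n => Re (\sum_(j < n) u j)) (2 * A).
  by move=> n m /tail; apply: le_trans; rewrite -ReN -ReD normr_Re_le.
have [|b bP] :=
    @cauchy_geometric_limit (fun n => Im (\sum_(j < n) u j)) (2 * A).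
  move=> n m /tail; apply: le_trans; apply: le_trans (normr_Im_le _).
  by case: (\sum_(j < m) u j) => ? ?; case: (\sum_(j < n) u j) => ? ?.
exists (a +i* b) => e e0.
have c0 : 0 < 4 * A + 1 by lra.
have half : 0 <= (2^-1 : R) < 1 by lra.
have [N NP] := expr_lt_eps half (divr_gt0 e0 c0).
exists N => n Nn; apply: le_trans (cmod_le_ReIm _) _.
have := aP n; have := bP n; case: (\sum_(j < n) u j) => x y /= h1 h2.
have h3 : 2^-1 ^+ n <= e / (4 * A + 1).
  by apply: le_trans NP; rewrite ler_wiXn2l //; lra.
have : (4 * A + 1) * 2^-1 ^+ n <= e by rewrite mulrC -ler_pdivlMr //; lra.
have : 0 <= (2^-1 : R) ^+ n by rewrite exprn_ge0 // invr_ge0.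
by lra.
Qed.

(** [normal_series P]: on every disc of radius less than 1, [P j] is
    [O(2 ^- j)] uniformly, so that the sum of the [P j] is holomorphic in the
    unit disc and can be differentiated term by term. *)
Definition normal_series (P : nat -> {poly C}) : Prop :=
  forall s : R, 0 <= s -> s < 1 -> exists A : R,
    forall j z, cmod z <= s -> cmod (P j).[z] <= A * 2^-1 ^+ j.

Lemma normal_series_deriv P :
  normal_series P -> normal_series (fun j => (P j)^`()).
Proof.
move=> nP s s0 s1; have rho0 : 0 < (1 - s) / 2 by lra.
have [||A PA] := nP ((1 + s) / 2); [lra | lra |].
exists (A / ((1 - s) / 2)) => j z zs; rewrite mulrAC.
apply: cauchy_deriv => // y yz; apply: PA.
by rewrite -(subrK z y) (le_trans (cmodD _ _)) //; lra.
Qed.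

Lemma normal_series_derivn P k :
  normal_series P -> normal_series (fun j => (P j)^`(k)).
Proof.
move=> nP; elim: k => //= k IH.
exact: (normal_series_deriv IH).
Qed.

Lemma normal_series_sum P : normal_series P ->
  exists F : C -> C, forall z, cmod z < 1 -> sums_to (fun j => (P j).[z]) (F z).
Proof.
move=> nP.
suff /choice[F FP] : forall z : C, exists S,
    cmod z < 1 -> sums_to (fun j => (P j).[z]) S by exists F.
move=> z; have [z1|] := boolP (cmod z < 1); last by exists 0.
have [A PA] := nP _ (cmod_ge0 z) z1.
by have [S uS] := sums_to_exists (fun j => PA j z (lexx _)); exists S.
Qed.

Lemma normal_series_differentiable P (F G : C -> C) z : normal_series P ->
  (forall y, cmod y < 1 -> sums_to (fun j => (P j).[y]) (F y)) ->
  sums_to (fun j => (P j)^`().[z]) (G z) -> cmod z < 1 ->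
  exists2 d : R, 0 < d & exists B : R, forall h, cmod h <= d ->
    cmod (F (z + h) - F z - h * G z) <= B * cmod h ^+ 2.
Proof.
move=> nP PF PG z1; have rho0 : 0 < (1 - cmod z) / 2 by lra.
set rho := (1 - cmod z) / 2 in rho0.
have z0 := cmod_ge0 z.
have [||A PA] := nP ((1 + cmod z) / 2); [lra | lra |].
exists (rho / 2); first by rewrite divr_gt0.
exists (4 * A / rho ^+ 2) => h hd.
have zh1 : cmod (z + h) < 1.
  by rewrite (le_lt_trans (cmodD _ _)) //; move: hd; rewrite /rho; lra.
have := sums_toB (sums_toB (PF _ zh1) (PF _ z1)) (sums_toZ h PG).
move=> /(@sums_to_tail _ _ (2 * A / rho ^+ 2 * cmod h ^+ 2) 0).
rewrite big_ord0 subr0 expr0 mulr1 => le_tail.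
have -> : 4 * A / rho ^+ 2 * cmod h ^+ 2
    = 2 * (2 * A / rho ^+ 2 * cmod h ^+ 2) by ring.
apply: le_tail => j _.
have -> : 2 * A / rho ^+ 2 * cmod h ^+ 2 * 2^-1 ^+ j
    = 2 * (A * 2^-1 ^+ j) / rho ^+ 2 * cmod h ^+ 2 by ring.
apply: cauchy_remainder => // y yz; apply: PA.
by rewrite -(subrK z y) (le_trans (cmodD _ _)) //; move: yz; rewrite /rho; lra.
Qed.

End NormalSeries.

(** * One step of the construction *)

Section Stage.
Variable R : realType.
Local Notation C := R[i].

Lemma cauchy_derivn (p : {poly C}) l (s rho M : R) : 0 < rho ->
  (forall z, cmod z <= s + l%:R * rho -> cmod p.[z] <= M) ->
  forall z, cmod z <= s -> cmod p^`(l).[z] <= M / rho ^+ l.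
Proof.
move=> rho0; elim: l s => [|l IH] s pM z zs.
  by rewrite expr0 divr1 pM // mul0r addr0.
rewrite exprSr invfM mulrA derivnS.
apply: cauchy_deriv => // y yz; apply: (IH (s + rho)) => [u us|].
  by apply: pM; rewrite -natr1; lra.
by rewrite -(subrK z y) (le_trans (cmodD _ _)) //; lra.
Qed.

Lemma leq_ffact l n : (0 < l <= n)%N -> (n <= n ^_ l)%N.
Proof.
case: l n => [|l] [|n] //= ln; rewrite ffactSS leq_pmulr // ffact_gt0.
by rewrite -ltnS.
Qed.

(** Given a partial sum [Q], a term [P] is found that is small on the disc of
    radius [s], brings the sum close to [T] on an arc of the circle of radius
    [r], and makes its [l]-th derivative at [r] large. The term is the sum of
    [chi * (T(z / r) - Q)], with [chi] close to the indicator function of the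
    arc, and of a monomial [c *: 'X^N] which is small in the disc of radius [r]
    but whose [l]-th derivative at [r] is large when [N] is. *)
Lemma stage (l : nat) (s r d e : R) (zeta : C) (Q T : {poly C}) :
  (0 < l)%N -> 0 <= s -> s < r -> r <= 1 -> 0 < d -> 0 < e -> cmod zeta = 1 ->
  exists P : {poly C},
    [/\ forall z, cmod z <= s -> cmod P.[z] <= e /\ cmod P^`(l).[z] <= e,
        forall z, cmod z = 1 -> d <= cmod (z - zeta) ->
          cmod ((Q + P).[r%:C * z] - T.[z]) <= e &
        2 <= cmod (Q + P)^`(l).[r%:C]].
Proof.
move=> l0 s0 sr r1 d0 e0 zeta1.
have r0 : 0 < r := le_lt_trans s0 sr.
have rC0 : r%:C != 0 by rewrite -cmod_gt0 cmod_real gtr0_norm.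
have l0R : 0 < l%:R :> R by rewrite ltr0n.
pose s' := (s + r) / 2; pose rho := (s' - s) / l%:R.
have s's : s < s' by rewrite /s'; lra.
have s'r : s' < r by rewrite /s'; lra.
have s'0 : 0 <= s' by lra.
have rho0 : 0 < rho by rewrite divr_gt0 // subr_gt0.
have s'E : s + l%:R * rho = s'.
  by rewrite /rho mulrC divfK ?gt_eqF // addrC subrK.
have rl0 : 0 < rho ^+ l by rewrite exprn_gt0.
(* a bound by [2 * e1] on the disc of radius [s'] gives a bound by [e] both on
   [P] and, by the Cauchy estimates, on its derivative in the smaller disc *)
pose e1 := Num.min (e / 2) (e * rho ^+ l / 2).
have e10 : 0 < e1 by rewrite lt_min !divr_gt0 // mulr_gt0.
have e1e : 2 * e1 <= e.
  have : e1 <= e / 2 by rewrite ge_min lexx.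
  by lra.
have e1l : 2 * e1 / rho ^+ l <= e.
  rewrite ler_pdivrMr //.
  have : e1 <= e * rho ^+ l / 2 by rewrite ge_min lexx orbT.
  by lra.
pose T' := T \Po (r%:C^-1 *: 'X) - Q.
have [B [B0 T'B]] := poly_bounded_unit_disc T'.
have [chi [chi0 chi1]] :=
  disc_arc_separation s'0 s'r r1 (mulr_gt0 d0 r0) zeta1 (divr_gt0 e10 B0).
pose P1 := chi * T'; pose v := (Q + P1)^`(l).[r%:C].
have [N lN vN] : exists2 N, (l <= N)%N & (2 + cmod v) / e1 <= N%:R.
  exists (maxn l (Num.bound ((2 + cmod v) / e1))); first exact: leq_maxl.
  apply: le_trans (_ : (Num.bound ((2 + cmod v) / e1))%:R <= _).
    by apply/ltW/archi_boundP; rewrite divr_ge0 ?addr_ge0 ?cmod_ge0 // ltW.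
  by rewrite ler_nat leq_maxr.
pose c := e1%:C / r%:C ^+ N.
have peak z : cmod z <= r -> cmod (c *: 'X^N).[z] <= e1.
  move=> zr; rewrite hornerZ hornerXn !cmodM cmodV !cmodX !cmod_real.
  rewrite !gtr0_norm // -mulrA ler_piMr // ?(ltW e10) // mulrC.
  by rewrite ler_pdivrMr ?exprn_gt0 // mul1r lerXn2r // nnegrE ?cmod_ge0 // ltW.
have P1disc z : cmod z <= s' -> cmod P1.[z] <= e1.
  move=> zs'; rewrite hornerM cmodM.
  apply: (@le_trans _ _ (e1 / B * B)); last by rewrite divfK // gt_eqF.
  by rewrite ler_pM ?cmod_ge0 ?chi0 ?T'B //; lra.
have Pdisc z : cmod z <= s' -> cmod (P1 + c *: 'X^N).[z] <= 2 * e1.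
  move=> zs'; rewrite hornerD (le_trans (cmodD _ _)) //.
  have zr : cmod z <= r by lra.
  by have := P1disc _ zs'; have := peak _ zr; lra.
exists (P1 + c *: 'X^N); split.
- move=> z zs; split; first by apply: le_trans (Pdisc _ _) _; lra.
  apply: le_trans e1l; apply: cauchy_derivn rho0 _ _ zs => y.
  by rewrite s'E; exact: Pdisc.
- move=> z z1 zd.
  have rz : cmod (r%:C * z) = r.
    by rewrite cmodM cmod_real gtr0_norm // z1 mulr1.
  have -> : (Q + (P1 + c *: 'X^N)).[r%:C * z] - T.[z] =
      (chi.[r%:C * z] - 1) * T'.[r%:C * z] + (c *: 'X^N).[r%:C * z].
    rewrite !hornerD hornerN hornerM /T' hornerD hornerN horner_comp.
    rewrite hornerZ hornerX mulKf //; ring.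
  rewrite (le_trans (cmodD _ _)) //.
  have : cmod (c *: 'X^N).[r%:C * z] <= e1 by rewrite peak // rz.
  suff : cmod ((chi.[r%:C * z] - 1) * T'.[r%:C * z]) <= e1 by lra.
  rewrite cmodM.
  apply: (@le_trans _ _ (e1 / B * B)); last by rewrite divfK // gt_eqF.
  rewrite ler_pM ?cmod_ge0 // ?T'B ?rz // chi1 //.
  by rewrite -mulrBr cmodM cmod_real gtr0_norm // mulrC ler_pM2l.
- have -> : (Q + (P1 + c *: 'X^N))^`(l).[r%:C] =
      v + c * (r%:C ^+ (N - l) *+ N ^_ l).
    by rewrite addrA derivnD hornerD derivnZ derivnXn hornerZ hornerMn hornerXn.
  have big : 2 + cmod v <= cmod (c * (r%:C ^+ (N - l) *+ N ^_ l)).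
    have -> : c * (r%:C ^+ (N - l) *+ N ^_ l) = e1%:C * (N ^_ l)%:R / r%:C ^+ l.
      rewrite -[_ *+ N ^_ l]mulr_natr /c.
      have -> : r%:C ^+ N = r%:C ^+ (N - l) * r%:C ^+ l by rewrite -exprD subnK.
      by field; rewrite !expf_neq0.
    rewrite !cmodM cmodV cmodX !cmod_real cmod_nat !gtr0_norm //.
    rewrite ler_pdivlMr ?exprn_gt0 //.
    have h1 : 0 <= 2 + cmod v by rewrite addr_ge0 ?cmod_ge0.
    apply: (@le_trans _ _ (2 + cmod v)).
      by rewrite ler_piMr // exprn_ile1 // ltW.
    rewrite mulrC -ler_pdivrMr // (le_trans vN) // ler_nat.
    by rewrite leq_ffact // l0.
  have := cmod_leB (c * (r%:C ^+ (N - l) *+ N ^_ l)) (- v).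
  by rewrite opprK cmodN [v + _]addrC; lra.
Qed.

End Stage.

(** * Enumeration of the radii and of the approximation tasks *)

Section Enumerations.
Variable R : realType.
Local Notation C := R[i].

Lemma injective_unbounded (f : nat -> nat) : injective f ->
  forall N, exists j, (N <= f j)%N.
Proof.
move=> finj N; have [//|no] := pselect (exists j, (N <= f j)%N).
have fN j : (f j < N)%N by rewrite ltnNge; apply/negP => h; apply: no; exists j.
have ginj : injective (fun j : 'I_N.+1 => Ordinal (fN j)).
  by move=> i j [] /finj /val_inj.
by have := leq_card _ ginj; rewrite !card_ord ltnn.
Qed.

(** The values of a sequence in [[0, 1[] converging to 1, listed in increasing
    order and without repetition. *)
Lemma increasing_enumeration (rho : nat -> R) :
  (forall n, 0 <= rho n < 1) ->
  (forall s, s < 1 -> exists N, forall n, (N <= n)%N -> s < rho n) ->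
  exists x : nat -> R,
    [/\ forall j, x j < x j.+1, forall j, exists n, x j = rho n,
        forall n, exists j, rho n = x j &
        forall s, s < 1 -> exists j, s < x j].
Proof.
move=> rho01 rho_cvg.
have next b : exists n, b < 1 ->
    b < rho n /\ forall m, b < rho m -> rho n <= rho m.
  have [b1|] := ltP b 1; last by exists 0%N.
  have [N0 N0P] := rho_cvg _ b1.
  have [N NP] := rho_cvg _ (proj2 (andP (rho01 N0))).
  have N0N : (N0 < N)%N.
    by rewrite ltnNge; apply/negP => h; have := NP _ h; rewrite ltxx.
  case: (@Order.TotalTheory.arg_minP _ _ _ (Ordinal N0N)
    (fun i : 'I_N => b < rho i) (fun i => rho i)) => [|i bi imin].
    exact: N0P.
  exists i => _; split=> // m bm; have [mN|Nm] := ltnP m N.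
    exact: (imin (Ordinal mN)).
  rewrite (le_trans (imin (Ordinal N0N) _)) //=; first exact: N0P.
  by rewrite ltW // NP.
have {next}[f fP] := choice next.
pose idx := fix idx j := if j is i.+1 then f (rho (idx i)) else f (-1).
pose x j := rho (idx j).
have x1 j : x j < 1 by have /andP[] := rho01 (idx j).
have x_lt j : x j < x j.+1 by have [] := fP _ (x1 j).
have x_min j m : x j < rho m -> x j.+1 <= rho m.
  by have [_] := fP _ (x1 j); apply.
have x0_min m : x 0%N <= rho m.
  have m11 : -1 < 1 :> R by rewrite gtrN.
  have [_] := fP _ m11; apply.
  by have /andP[rm0 _] := rho01 m; rewrite (lt_le_trans (ltrN10 _)).
have x_mono i j : (i < j)%N -> x i < x j.
  elim: j => // j IH; rewrite ltnS leq_eqVlt => /predU1P[->|/IH h].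
    exact: x_lt.
  exact: lt_trans h (x_lt j).
have idx_inj : injective idx.
  move=> i j ij; case: (ltngtP i j) => // /x_mono; rewrite /x ij ltxx //.
have x_cvg s : s < 1 -> exists j, s < x j.
  move=> /rho_cvg[N NP]; have [j jN] := injective_unbounded idx_inj N.
  by exists j; exact: NP.
exists x; split=> // [j|n]; first by exists (idx j).
have [[j xj] //|no] := pselect (exists j, rho n = x j); first by exists j.
have xn j : x j < rho n.
  have le : x j <= rho n.
    elim: j => [|j IH]; first exact: x0_min.
    apply: x_min; rewrite lt_neqAle IH andbT; apply/eqP => h.
    by apply: no; exists j.
  by rewrite lt_neqAle le andbT; apply/eqP => h; apply: no; exists j.
have [j] := x_cvg _ (proj2 (andP (rho01 n))).
by have := xn j; lra.
Qed.

(** The point of the plane with given rational coordinates. *)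
Definition ratC (a : rat * rat) : C := ratr a.1 +i* ratr a.2.

Lemma ratC_dense (c : C) (e : R) : 0 < e -> exists a, cmod (c - ratC a) <= e.
Proof.
case: c => u v e0.
have dense (t : R) : exists q, `|t - ratr q| <= e / 2.
  have [|q] := @rat_in_itvoo R (t - e / 2) (t + e / 2); first by lra.
  by rewrite in_itv /= => /andP[h1 h2]; exists q; apply/ler_normlP; split; lra.
have [a ua] := dense u; have [b vb] := dense v.
exists (a, b); apply: le_trans (cmod_le_ReIm _) _ => /=; lra.
Qed.

(** The polynomial with given rational complex coefficients, from the constant
    one up. *)
Definition ratP (s : seq (rat * rat)) : {poly C} := Poly (map ratC s).

Lemma ratP_dense (p : {poly C}) (e : R) : 0 < e ->
  exists s, forall z, cmod z <= 1 -> cmod (p.[z] - (ratP s).[z]) <= e.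
Proof.
elim/poly_ind: p e => [|p c IH] e e0.
  by exists [::] => z _; rewrite /ratP /= subrr cmod0 ltW.
have e2 : 0 < e / 2 by rewrite divr_gt0.
have [s sP] := IH _ e2; have [a ac] := ratC_dense c e2.
exists (a :: s) => z z1; rewrite /ratP /= horner_cons hornerMXaddC.
have -> : forall u v : C, u * z + c - (v * z + ratC a) =
    (u - v) * z + (c - ratC a) by move=> u v; ring.
rewrite (le_trans (cmodD _ _)) // cmodM.
have : cmod (p.[z] - (ratP s).[z]) * cmod z <= e / 2.
  by rewrite -[e / 2]mulr1 ler_pM ?cmod_ge0 // sP.
by rewrite /ratP; lra.
Qed.

(** A sequence of approximation tasks, each consisting of an arc of the unit
    circle (the complement of a ball centered on the circle) and of a
    polynomial: every polynomial on every arc is approximated by arbitrarily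
    late tasks. *)
Lemma tasks_exist :
  exists (zeta : nat -> C) (d : nat -> R) (T : nat -> {poly C}),
  [/\ forall j, cmod (zeta j) = 1, forall j, 0 < d j &
      forall (zeta0 : C) (d0 e : R) p J, cmod zeta0 = 1 -> 0 < d0 -> 0 < e ->
        exists2 j, (J <= j)%N &
          (forall z, d0 <= cmod (z - zeta0) -> d j <= cmod (z - zeta j)) /\
          (forall z, cmod z <= 1 -> cmod (p.[z] - (T j).[z]) <= e)].
Proof.
(* a rational point near the center of the ball, a natural number [n] for the
   radius [1 / n.+1], the coefficients of the polynomial, and a dummy component
   that repeats the task *)
pose task := (rat * rat * nat * seq (rat * rat) * nat)%type.
(* a point of the circle close to the rational point, if there is one *)
have center (t : task) : exists zeta : C, cmod zeta = 1 /\
    ((exists zeta' : C, cmod zeta' = 1 /\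
       cmod (zeta' - ratC t.1.1.1) <= t.1.1.2.+1%:R^-1) ->
     cmod (zeta - ratC t.1.1.1) <= t.1.1.2.+1%:R^-1).
  have [[zeta' [h1 h2]]|no] := pselect (exists zeta' : C, cmod zeta' = 1 /\
       cmod (zeta' - ratC t.1.1.1) <= t.1.1.2.+1%:R^-1).
    by exists zeta'.
  by exists 1; split; [exact: cmod1|].
have {center}[ctr ctrP] := choice center.
pose t0 : task := (0, 0, 0%N, [::], 0%N).
pose dec j : task := odflt t0 (unpickle j).
exists (fun j => ctr (dec j)), (fun j => (dec j).1.1.2.+1%:R^-1),
  (fun j => ratP (dec j).1.2).
split=> [j|j|zeta0 d0 e p J zeta01 d00 e0].
- by have [] := ctrP (dec j).
- by rewrite invr_gt0 ltr0n.
have [n nP] : exists n : nat, 3 * n.+1%:R^-1 <= d0.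
  exists (Num.bound (3 / d0)); rewrite ler_pdivrMr ?ltr0n //.
  rewrite mulrC -ler_pdivrMr // ltW // (lt_trans (archi_boundP _)) //.
    by rewrite divr_ge0 // ltW.
  by rewrite ltr_nat.
have n0 : 0 < n.+1%:R^-1 :> R by rewrite invr_gt0 ltr0n.
have [a aP] := ratC_dense zeta0 n0.
have [s sP] := ratP_dense p e0.
have finj : injective (fun m : nat => pickle ((a, n, s, m) : task)).
  by move=> m m' /(pcan_inj (@choice.pickleK task))[].
have [m mJ] := injective_unbounded finj J.
exists (pickle ((a, n, s, m) : task)) => //.
have -> : dec (pickle ((a, n, s, m) : task)) = (a, n, s, m).
  by rewrite /dec choice.pickleK.
split=> // z zd; have [_ /=] := ctrP (a, n, s, m).
move=> h; have {h} cP := h (ex_intro _ zeta0 (conj zeta01 aP)).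
set ct := ctr _ in cP *.
have : cmod (z - zeta0) <=
    cmod (z - ct) + (cmod (ct - ratC a) + cmod (zeta0 - ratC a)).
  have -> : z - zeta0 = (z - ct) + ((ct - ratC a) - (zeta0 - ratC a)) by ring.
  by rewrite (le_trans (cmodD _ _)) // lerD2l cmodB.
by move: nP aP cP zd; rewrite -/ct; move: (n.+1%:R^-1) => u; lra.
Qed.

End Enumerations.

(** * The universal series *)

Section Construction.
Variable R : realType.
Local Notation C := R[i].

(** The inductive construction. The polynomial [Q j] is the sum of the terms
    [P 0, ..., P j], and the stage leading from [Q j] to [Q j.+1] treats the
    radius [x j.+1]; the term [P 0] has a large [l]-th derivative at [x 0]. *)
Theorem universal_series (rho : nat -> R) (l : nat) : (0 < l)%N ->
  (forall n, 0 <= rho n < 1) ->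
  (forall s, s < 1 -> exists N, forall n, (N <= n)%N -> s < rho n) ->
  exists P : nat -> {poly C}, [/\ normal_series P,
    forall F : C -> C,
      (forall z, cmod z < 1 -> sums_to (fun j => (P j).[z]) (F z)) ->
      forall (zeta : C) (d e : R) (p : {poly C}),
        cmod zeta = 1 -> 0 < d -> 0 < e ->
        exists n, forall z, cmod z = 1 -> d <= cmod (z - zeta) ->
          cmod (F ((rho n)%:C * z) - p.[z]) <= e &
    forall n (S : C),
      sums_to (fun j => (P j)^`(l).[(rho n)%:C]) S -> 1 <= cmod S].
Proof.
move=> l0 rho01 rho_cvg.
have [x [x_lt x_rho rho_x x_cvg]] := increasing_enumeration rho01 rho_cvg.
have x0 j : 0 <= x j by have [n ->] := x_rho j; have /andP[] := rho01 n.
have x1 j : x j < 1 by have [n ->] := x_rho j; have /andP[] := rho01 n.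
have x_mono i j : (i <= j)%N -> x i <= x j.
  move=> /subnKC <-; elim: (j - i)%N => [|k IH]; first by rewrite addn0.
  by rewrite addnS (le_trans IH) // ltW.
have [zeta [d [T [zeta1 d0 tasks]]]] := tasks_exist R.
pose eps j : R := 2^-1 ^+ j.+2.
have eps0 j : 0 < eps j by rewrite exprn_gt0 // invr_gt0.
have /choice[next nextP] : forall jQ : nat * {poly C}, exists P : {poly C},
    [/\ forall z, cmod z <= x jQ.1 ->
          cmod P.[z] <= eps jQ.1 /\ cmod P^`(l).[z] <= eps jQ.1,
        forall z, cmod z = 1 -> d jQ.1 <= cmod (z - zeta jQ.1) ->
          cmod ((jQ.2 + P).[(x jQ.1.+1)%:C * z] - (T jQ.1).[z]) <= eps jQ.1 &
        2 <= cmod (jQ.2 + P)^`(l).[(x jQ.1.+1)%:C]].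
  by move=> [j Q] /=; apply: stage => //; exact: ltW.
pose Q := fix Q j : {poly C} :=
  if j is i.+1 then Q i + next (i, Q i) else 2 *: 'X^l.
pose P j : {poly C} := if j is i.+1 then next (i, Q i) else 2 *: 'X^l.
have sumP j : \sum_(i < j.+1) P i = Q j.
  elim: j => [|j IH]; first by rewrite big_ord_recr big_ord0 /= add0r.
  by rewrite big_ord_recr IH.
have small i j z : (j < i)%N -> cmod z <= x j ->
    cmod (P i).[z] <= 2^-1 * 2^-1 ^+ i /\
    cmod (P i)^`(l).[z] <= 2^-1 * 2^-1 ^+ i.
  case: i => // i; rewrite ltnS => ji zx; rewrite -exprS.
  by have [h _ _] := nextP (i, Q i); apply: h; rewrite (le_trans zx) // x_mono.
have tail (D : {poly C} -> {poly C}) j z S :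
    (forall i, (j < i)%N -> cmod (D (P i)).[z] <= 2^-1 * 2^-1 ^+ i) ->
    sums_to (fun i => (D (P i)).[z]) S ->
    cmod (S - \sum_(i < j.+1) (D (P i)).[z]) <= 2 * eps j.
  move=> DP /(@sums_to_tail _ _ _ 2^-1 j.+1)/(_ DP)/le_trans; apply.
  by rewrite /eps [2^-1 ^+ j.+2]exprS mulrA.
exists P; split.
- move=> s s0 s1; have [J sJ] := x_cvg _ s1.
  have [B BP] := choice (fun j => poly_bounded_unit_disc (P j)).
  exists (1 + \sum_(i < J.+1) B i * 2 ^+ i) => j z zs.
  have B0 i : 0 <= B i * 2 ^+ i.
    by rewrite mulr_ge0 ?exprn_ge0 // ltW //; have [] := BP i.
  have h0 : 0 <= (2^-1 : R) ^+ j by rewrite exprn_ge0 // invr_ge0.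
  have [jJ|Jj] := leqP j J.
    apply: (@le_trans _ _ (B j * 2 ^+ j * 2^-1 ^+ j)).
      rewrite -mulrA -exprMn divff ?pnatr_eq0 // expr1n mulr1.
      by have [_ h] := BP j; apply: h; lra.
    rewrite ler_wpM2r // (bigD1 (Ordinal (jJ : (j < J.+1)%N))) //=.
    have : 0 <= \sum_(i < J.+1 | i != Ordinal (jJ : (j < J.+1)%N)) B i * 2 ^+ i.
      by rewrite sumr_ge0.
    by lra.
  have zJ : cmod z <= x J by rewrite (le_trans zs) // ltW.
  have [h _] := small _ _ _ Jj zJ; apply: le_trans h _.
  rewrite ler_wpM2r //.
  have : 0 <= \sum_(i < J.+1) B i * 2 ^+ i by rewrite sumr_ge0.
  by lra.
- move=> F FP zeta0 d' e p zeta01 d'0 e0.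
  have half : 0 <= (2^-1 : R) < 1 by lra.
  have e2 : 0 < e / 2 by rewrite divr_gt0.
  have [J JP] := expr_lt_eps half e2.
  have [j Jj [arc Tp]] := tasks zeta0 d' (e / 2) p J zeta01 d'0 e2.
  have [n xn] := x_rho j.+1; exists n => z z1 zd; rewrite -xn.
  have [_ hT _] := nextP (j, Q j); have {hT} := hT _ z1 (arc _ zd) => /=.
  set y := (x j.+1)%:C * z.
  have yx : cmod y = x j.+1 by rewrite cmodM cmod_real z1 mulr1 ger0_norm.
  have := tail id j.+1 y (F y) _ (FP _ _).
  rewrite -horner_sum sumP /= yx => /(_ _ (x1 _)) ht hT.
  have {ht} ht : cmod (F y - (Q j + next (j, Q j)).[y]) <= 2 * eps j.+1.
    by apply: ht => i ji; have [] := small _ _ y ji; rewrite ?yx.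
  have hp := Tp z; rewrite z1 cmodBC in hp; have {hp} hp := hp (lexx _).
  have ej : 2^-1 ^+ j <= e / 2.
    by apply: le_trans JP; rewrite ler_wiXn2l //; lra.
  have -> : F y - p.[z] = (F y - (Q j + next (j, Q j)).[y]) +
    (((Q j + next (j, Q j)).[y] - (T j).[z]) + ((T j).[z] - p.[z])) by ring.
  rewrite (le_trans (cmodD _ _)) //.
  have := cmodD ((Q j + next (j, Q j)).[y] - (T j).[z]) ((T j).[z] - p.[z]).
  have : 0 <= (2^-1 : R) ^+ j by rewrite exprn_ge0 // invr_ge0.
  by move: ht hT; rewrite /eps !exprS; lra.
- move=> n S; have [j ->] := rho_x n => PS.
  have xj : cmod (x j)%:C = x j by rewrite cmod_real ger0_norm.
  have := tail (derivn l) j (x j)%:C S _ PS.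
  rewrite -horner_sum -[\sum_(i < j.+1) _]linear_sum sumP => ht.
  have {ht} ht : cmod (S - (Q j)^`(l).[(x j)%:C]) <= 2 * eps j.
    by apply: ht => i ji; have [] := small _ _ (x j)%:C ji; rewrite ?xj.
  have Q2 : 2 <= cmod (Q j)^`(l).[(x j)%:C].
    case: j {PS xj ht} => [|j]; last by have [] := nextP (j, Q j).
    rewrite /= derivnZ derivnXn subnn ffactnn hornerZ hornerMn hornerXn expr0.
    by rewrite cmodM !cmod_nat ler_peMr // ler1n fact_gt0.
  have e1 : eps j <= 1 / 4.
    have : (2^-1 : R) ^+ j <= 1 by rewrite exprn_ile1 // ?invr_ge0 //; lra.
    by rewrite /eps !exprS; lra.
  have := cmod_leB (Q j)^`(l).[(x j)%:C] S; move: ht; rewrite cmodBC; lra.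
Qed.

End Construction.

(** * Topology of the complex plane in terms of the modulus *)

Section Topology.
Variable R : realType.
Local Notation C := (Cplx R).

Lemma Cplx_gt0 (e : C) : 0 < e -> exists2 r : R, 0 < r & e = r%:C.
Proof.
by case: e => a b; rewrite ltcE /= => /andP[/eqP -> a0]; exists a.
Qed.

Lemma Cplx_ballE (x y : C) (r : R) : ball x r%:C y = (cmod (x - y : R[i]) < r).
Proof. by rewrite -ball_normE /ball_ /= normC_cmod ltcR. Qed.

Lemma Cplx_nbhsP (x : C) (A : set C) : nbhs x A <->
  exists2 r : R, 0 < r & forall y : C, cmod (x - y : R[i]) < r -> A y.
Proof.
split.
  move=> /nbhs_ballP[e /= /Cplx_gt0[r r0 ->] rA]; exists r => // y yr.
  by apply: rA; rewrite Cplx_ballE.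
move=> [r r0 rA]; apply/nbhs_ballP; exists r%:C => /=; first by rewrite ltcR.
by move=> y; rewrite Cplx_ballE; exact: rA.
Qed.

Lemma Cplx_entourageP (E : set (C * C)) : entourage E <->
  exists2 r : R, 0 < r & forall x y : C, cmod (x - y : R[i]) < r -> E (x, y).
Proof.
rewrite -entourage_ballE; split.
  move=> [e /= /Cplx_gt0[r r0 ->] rE]; exists r => // x y xy.
  by apply: rE => /=; rewrite Cplx_ballE.
move=> [r r0 rE]; exists r%:C => /=; first by rewrite ltcR.
by move=> [x y] /=; rewrite Cplx_ballE; exact: rE.
Qed.

Lemma Cplx_hausdorff : hausdorff_space C.
Proof. exact: norm_hausdorff. Qed.

(** A remainder bounded by the square of the increment gives the complex
    derivative. *)
Lemma Cplx_derive1_quadratic (F : C -> C) (z D : C) (d B : R) : 0 < d ->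
  (forall h : C, cmod h <= d ->
     cmod (F (z + h) - F z - h * D) <= B * cmod h ^+ 2) ->
  derivable F z 1 /\ derive1 F z = D.
Proof.
move=> d0 FB.
have cv : (fun h : C => h^-1 *: (F (h + z) - F z)) @ 0^' --> D.
  apply/cvgrPdist_le => e /Cplx_gt0[r r0 ->].
  have B1 : 0 < `|B| + 1 by rewrite ltr_wpDl.
  near=> h.
  have h0 : h != 0 by near: h; exact: nbhs_dnbhs_neq.
  have hd : cmod h < Num.min d (r / (`|B| + 1)).
    near: h; apply: nbhs_dnbhs; apply/Cplx_nbhsP.
    exists (Num.min d (r / (`|B| + 1))); first by rewrite lt_min d0 divr_gt0.
    by move=> y; rewrite sub0r cmodN.
  have hn : 0 < cmod h by rewrite cmod_gt0.
  move: hd; rewrite lt_min => /andP[hd hr].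
  have -> : D - h^-1 *: (F (h + z) - F z) =
      - (h^-1 * (F (z + h) - F z - h * D)).
    rewrite [h + z]addrC /GRing.scale /= [in RHS]mulrBr mulKf //.
    by rewrite opprB.
  rewrite normC_cmod lecR cmodN cmodM cmodV mulrC ler_pdivrMr //.
  apply: le_trans (FB h (ltW hd)) _; rewrite expr2 mulrA ler_wpM2r ?ltW //.
  have := ler_norm B; move: hr; rewrite ltr_pdivlMr //.
  by nra.
split; last exact/cvg_lim.
apply/cvg_ex; exists D.
have -> // : (fun h : C => h^-1 *: (F (h *: 1 + z) - F z)) =
  (fun h : C => h^-1 *: (F (h + z) - F z)).
by apply/funext => h; rewrite [h *: 1]mulr1.
Unshelve. all: by end_near. Qed.

Lemma unit_discE (z : C) : unit_disc z = (cmod z < 1 : Prop).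
Proof. by rewrite /unit_disc /= normC_cmod -[1]/(1%:C) ltcR. Qed.

Lemma unit_circleE (z : C) : unit_circle z <-> cmod z = 1.
Proof.
rewrite /unit_circle /= normC_cmod; split => [[]//|->].
by rewrite rmorph1.
Qed.

(** Termwise differentiation. *)
Lemma normal_series_derive1n (P : nat -> {poly R[i]}) (F : C -> C) :
  normal_series P ->
  (forall z, cmod z < 1 -> sums_to (fun j => (P j).[z]) (F z)) ->
  forall k z, cmod z < 1 ->
    sums_to (fun j => (P j)^`(k).[z]) (derive1n k F z) /\
    derivable (derive1n k F) z 1.
Proof.
move=> nP PF.
have step k (H : C -> C) :
    (forall z, cmod z < 1 -> sums_to (fun j => (P j)^`(k).[z]) (H z)) ->
    forall z, cmod z < 1 -> derivable H z 1 /\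
      sums_to (fun j => (P j)^`(k.+1).[z]) (derive1 H z).
  move=> PH z z1.
  have [G PG] := normal_series_sum (normal_series_derivn k.+1 nP).
  have [d d0 [B HB]] := @normal_series_differentiable _ _ H G z
    (normal_series_derivn k nP) PH (PG z z1) z1.
  have [dH dHE] := Cplx_derive1_quadratic d0 HB.
  by rewrite dHE; split => //; exact: PG.
elim=> [|k IH] z z1.
  by have [? _] := step 0%N F PF z z1; split=> //; exact: PF.
have PH z' : cmod z' < 1 ->
    sums_to (fun j => (P j)^`(k.+1).[z']) (derive1n k.+1 F z').
  by move=> z'1; have [_] := step k _ (fun y y1 => proj1 (IH y y1)) z' z'1.
by split; [exact: PH | have [] := step k.+1 _ PH z z1].
Qed.

(** * Continuous functions on a compact set *)

Lemma Cplx_within_continuous (K : set C) (f : C -> C) (z : C) (e : R) :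
  {within K, continuous f} -> K z -> 0 < e -> exists2 d : R, 0 < d &
    forall y, K y -> cmod (z - y : R[i]) < d -> cmod (f z - f y : R[i]) < e.
Proof.
move=> /subspace_continuousP/[apply] fz e0.
have : nbhs (f z) [set w : C | cmod (f z - w : R[i]) < e].
  by apply/Cplx_nbhsP; exists e.
move=> /fz; rewrite /= /nbhs /= /within /= => /Cplx_nbhsP[d d0 dP].
by exists d => // y Ky zy; exact: dP.
Qed.

Lemma Cplx_compact_uniform_continuous (K : set C) (f : C -> C) (e : R) :
  compact K -> {within K, continuous f} -> 0 < e ->
  exists2 eta : R, 0 < eta & forall z z', K z -> K z' ->
    cmod (z - z' : R[i]) <= eta -> cmod (f z - f z' : R[i]) <= e.
Proof.
move=> /compact_near_coveringP cK fK e0.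
pose P (eta : R) (z : C) := K z -> forall z', K z' ->
    cmod (z - z' : R[i]) <= eta -> cmod (f z - f z' : R[i]) <= e.
have PK x : K x -> \forall z \near x & eta \near (0 : R)^'+, P eta z.
  have e2 : 0 < e / 2 by rewrite divr_gt0.
  move=> Kx; have [d d0 dP] := Cplx_within_continuous fK Kx e2.
  exists ([set z : C | cmod (x - z : R[i]) < d / 2],
          [set eta : R | eta < d / 2]).
    split => /=; last by apply: nbhs_right_lt; rewrite divr_gt0.
    by apply/Cplx_nbhsP; exists (d / 2); rewrite ?divr_gt0.
  move=> [z eta] /= [xz etad] Kz z' Kz' zz'.
  have -> : f z - f z' = (f x - f z') - (f x - f z) by ring.
  rewrite (le_trans (cmodB _ _)) //.
  have h1 : cmod (f x - f z : R[i]) < e / 2 by apply: dP => //; lra.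
  have h2 : cmod (f x - f z' : R[i]) < e / 2.
    apply: dP => //; have -> : x - z' = (x - z) + (z - z') by ring.
    by rewrite (le_lt_trans (cmodD _ _)) //; lra.
  by lra.
have : \forall eta \near (0 : R)^'+, K `<=` P eta by exact: (cK R _ P _ PK).
move=> KP; have [eta [eta0 etaP]] : exists eta : R, 0 < eta /\ K `<=` P eta.
  near (0 : R)^'+ => eta; exists eta; split; last by near: eta.
  by near: eta; exact: nbhs_right_gt.
by exists eta => // z z' Kz Kz' zz'; exact: etaP.
Unshelve. all: by end_near. Qed.

Lemma Cplx_compact_bounded (K : set C) (f : C -> C) :
  compact K -> {within K, continuous f} ->
  exists M : R, forall z, K z -> cmod (f z : R[i]) <= M.
Proof.
move=> /compact_near_coveringP cK fK.
pose P (M : R) (z : C) := K z -> cmod (f z : R[i]) <= M.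
have PK x : K x -> \forall z \near x & M \near +oo, P M z.
  move=> Kx; have [d d0 dP] := Cplx_within_continuous fK Kx (@ltr01 R).
  exists ([set z : C | cmod (x - z : R[i]) < d],
          [set M : R | cmod (f x : R[i]) + 1 < M]).
    split => /=; last by apply: nbhs_pinfty_gt; rewrite num_real.
    by apply/Cplx_nbhsP; exists d.
  move=> [z M] /= [xz fM] Kz; have := dP _ Kz xz.
  rewrite cmodBC; have := cmod_leB (f z) (f x); lra.
have KP : \forall M \near +oo, K `<=` P M by exact: (cK R _ P _ PK).
have [M MP] : exists M : R, K `<=` P M.
  by near (+oo : set_system R) => M; exists M; near: M.
by exists M => z Kz; exact: MP.
Unshelve. all: by end_near. Qed.

(** * Universality in terms of the modulus *)

Lemma Abel_universal_closureP (rho : nat -> R) (f : C -> C) (K : set C)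
    (g : {uniform` K -> C}) :
  closure (range (fun n => dilate f (rho n) : {uniform` K -> C})) g <->
  forall e : R, 0 < e -> exists n, forall z, K z ->
    cmod (g z - f ((rho n)%:C * z) : R[i]) < e.
Proof.
split=> [clg e e0|approx B /uniform_nbhs[E [/Cplx_entourageP[e e0 eE] EB]]].
  have [|_ [[n _ <-] nP]] := clg [set h : {uniform` K -> C} |
      forall z, K z -> cmod (g z - h z : R[i]) < e].
    apply/uniform_nbhs; exists [set xy : C * C | cmod (xy.1 - xy.2 : R[i]) < e].
    by split => //; apply/Cplx_entourageP; exists e.
  by exists n.
have [n nP] := approx e e0; exists (dilate f (rho n)); split; first by exists n.
by apply: EB => z Kz; apply: eE; exact: nP.
Qed.

(** Testing universality on the compact set reduced to the point 1. *)
Lemma Abel_universal_at1 (rho : nat -> R) (f : C -> C) :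
  Abel_universal rho f -> exists n, cmod (f (rho n)%:C : R[i]) < 1.
Proof.
move=> [_ univ]; have K1 : compact [set (1 : C)] by exact: compact_set1.
have sub : [set (1 : C)] `<=` @unit_circle R.
  by move=> _ ->; apply/unit_circleE; exact: cmod1.
have neq : [set (1 : C)] <> @unit_circle R.
  move=> eq1; have : unit_circle (-1 : C).
    by apply/unit_circleE; rewrite cmodN cmod1.
  rewrite -eq1 /= => /eqP; rewrite eq_sym -subr_eq0 opprK.
  by rewrite (_ : 1 + 1 = 2%:R) // pnatr_eq0.
have c0 : {within [set (1 : C)], continuous (cst 0 : C -> C)}.
  exact: cst_continuous.
have /Abel_universal_closureP/(_ 1 ltr01)[n nP] := univ _ K1 sub neq _ c0.
by exists n; have := nP 1 erefl; rewrite /cst sub0r cmodN mulr1.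
Qed.

Lemma circle_compact_arc (K : set C) : compact K -> K `<=` @unit_circle R ->
  K <> @unit_circle R -> exists (zeta : C) (d : R),
    [/\ cmod zeta = 1, 0 < d & forall z, K z -> d <= cmod (z - zeta : R[i])].
Proof.
move=> cK subK neqK.
have [zeta [zeta1 Kzeta]] : exists zeta : C, unit_circle zeta /\ ~ K zeta.
  apply: contrapT => no; apply: neqK; apply/seteqP; split=> // z z1.
  by apply: contrapT => Kz; apply: no; exists z.
have : nbhs zeta (~` K).
  apply: open_nbhs_nbhs; split => //; apply: closed_openC.
  exact: compact_closed Cplx_hausdorff cK.
move=> /Cplx_nbhsP[d d0 dP]; exists zeta, d; split=> //.
  by move/unit_circleE: zeta1.
by move=> z Kz; rewrite leNgt cmodBC; apply/negP => /dP.
Qed.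

End Topology.

Theorem theorem4p1 (R : realType) (rho : nat -> R) (l : nat)
    (hrho : forall n, 0 <= rho n < 1) (hlim : rho @ \oo --> (1 : R))
    (hl : (1 <= l)%N) :
  exists f : Cplx R -> Cplx R,
    Abel_universal rho f /\ ~ Abel_universal rho (derive1n l f).
Proof.
have rho_cvg s : s < 1 -> exists N, forall n, (N <= n)%N -> s < rho n.
  by move=> s1; have [N _ NP] := cvgr_gt _ hlim _ s1; exists N => n; exact: NP.
have [P [nP approx lower]] := universal_series hl hrho rho_cvg.
have [F PF] := normal_series_sum nP.
have dF := normal_series_derive1n nP PF.
exists F; split.
  split=> [z /=|K cK subK neqK g cg].
    by rewrite unit_discE => z1; have [] := dF 0%N z z1.
  apply/Abel_universal_closureP => e e0.
  have [zeta [d [zeta1 d0 Kd]]] := circle_compact_arc cK subK neqK.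
  have KP z : K z -> cmod z = 1 /\ d <= cmod (z - zeta).
    by move=> Kz; split; [apply/unit_circleE; exact: subK | exact: Kd].
  have e3 : 0 < e / 3 by rewrite divr_gt0.
  have [p gp] := poly_dense_arc zeta1 d0 KP
    (fun e' => Cplx_compact_uniform_continuous cK cg)
    (Cplx_compact_bounded cK cg) e3.
  have [n nP'] := approx F PF zeta d (e / 3) p zeta1 d0 e3.
  exists n => z Kz; have [z1 zd] := KP z Kz.
  have := nP' z z1 zd; rewrite cmodBC; have := gp z Kz.
  have := cmodD (g z - p.[z]) (p.[z] - F ((rho n)%:C * z)).
  by rewrite addrA subrK; lra.
move=> /Abel_universal_at1[n].
have rn1 : cmod ((rho n)%:C : R[i]) < 1.
  by have /andP[r0 r1] := hrho n; rewrite cmod_real ger0_norm.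
have [PS _] := dF l _ rn1.
by have := lower n _ PS; lra.
Qed.
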